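(* Fix $0<\theta<\frac16$. Then $$P_N\left(S^{\bullet}(N,N-t,j)\right)=\frac{N^{-3/2}}{2\sqrt{\pi}\left(1-\frac{N-t-j}{N}\right)^{3/2}\left(\frac{N-t-j}{N}\right)^{3/2}}\left(1+O\!\left(N^{3\theta-\frac12}\right)\right)$$ for $0\prec\!\prec j\prec\!\prec N-t\prec\!\prec N$. Explicitly: for every $\epsilon>0$ there exist constants $C$ and $N_1$ (depending on $\epsilon$ and $\theta$) such that for all integers $N\ge N_1$ and $t,j$ with $j>\epsilon N$, $N-t-j>\epsilon N$ and $t>\epsilon N$, one has $$P_N\left(S^{\bullet}(N,N-t,j)\right)=\frac{N^{-3/2}}{2\sqrt{\pi}\left(1-\frac{N-t-j}{N}\right)^{3/2}\left(\frac{N-t-j}{N}\right)^{3/2}}\left(1+\delta\right)$$ for some real number $\delta=\delta(N,t,j)$ with $|\delta|\le C N^{3\theta-1/2}$.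
   Context: $S_N(312)$ is the set of permutations $\sigma=\sigma_1\ldots\sigma_N$ of $1,\dots,N$ for which there are no indices $i_1<i_2<i_3$ with $\sigma_{i_1}>\sigma_{i_3}>\sigma_{i_2}$. $P_N$ is the uniform probability distribution on $S_N(312)$: $P_N(A)=|A|/|S_N(312)|$. For integers $i,j\in[1,N]$, $S^{\bullet}(N,i,j)=\{\sigma\in S_N(312):\sigma_i=j\}$. The notation $f(N)\prec\!\prec g(N)$ means that there is an $\epsilon>0$ such that $g(N)-f(N)>\epsilon N$ for all sufficiently large $N$; a statement with an $O$-term ''for $f\prec\!\prec g$'' means that for every $\epsilon>0$ the $O$-bound holds with constants depending only on $\epsilon$ (and the fixed parameters), uniformly over all indices with $g-f>\epsilon N$ and $N$ at least some $N_1$ depending on $\epsilon$. *)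

(* Defs.v *)
From mathcomp Require Export all_boot all_order all_algebra all_fingroup.
From mathcomp Require Export all_classical all_reals all_analysis.

Set Implicit Arguments.
Unset Strict Implicit.
Unset Printing Implicit Defensive.

Import Order.TTheory GRing.Theory Num.Theory.

Local Open Scope nat_scope.

(* One-line notation: the permutation s of 'I_N stands for the word
   s 0, ..., s (N - 1), with both positions and values shifted down by one. *)
Definition avoids312 (N : nat) (s : 'S_N) : bool :=
  ~~ [exists i1 : 'I_N, exists i2 : 'I_N, exists i3 : 'I_N,
        [&& i1 < i2, i2 < i3, s i3 < s i1 & s i2 < s i3]].

Definition S312 (N : nat) : finType := {s : 'S_N | avoids312 s}.

Definition P312 (R : realType) (N : nat) (A : {set S312 N}) : R :=
  (#|A|%:R / #|S312 N|%:R)%R.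

(* The indices i and j are 1-based; the set is empty unless both lie in
   [1, N]. *)
Definition Sbullet (N i j : nat) : {set S312 N} :=
  [set s : S312 N |
    [exists k : 'I_N, (k.+1 == i) && ((val s k).+1 == j)]].

(* Main.v *)
Require Import Defs.
From mathcomp Require Import zify ring lra.

(** Read a 312-avoiding permutation of 1, ..., N as the output of a stack fed
    with 1, ..., N in this order: pushes and pops are the up and down steps of
    a Dyck path, and the value j leaves in position i exactly when the j-th up
    step is matched with the i-th down step.  Cut the path at these two steps.
    If j is pushed at height k, the first part has n = j - 1 ups and ends at
    height k, the part between the two steps is a Dyck path with d + k ups,
    where d = i - j, and the last part, read backwards, has t = N - i ups and
    ends at height k.  Writing [ballot n k] for the number of nonnegative paths
    with n ups and n - k downs, the number of permutations is
      [height_sum d n t] = sum_k catalan (d + k) * ballot n k * ballot t k.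
    The proof of [card_Sbullet] does not go through paths: the position of the
    least letter splits a 312-avoiding word in two, and [height_sum] satisfies
    the recursion that this gives ([height_sumS], [count_words]).

    For the asymptotics the sum is compared with one that has a closed form.
    Cutting a Dyck path with n + t ups just before its (n + 1)-st up step gives
      sum_k ballot n k * ballot (t + k) (k + 1) = catalan (n + t)
    ([ballot_cut]).  The factors catalan (d + k) * ballot t k / (k + 1) and
    catalan d * ballot (t + k) (k + 1) / (k + 2) have explicit ratios between
    consecutive k, equal up to O(1/N + k^2/N^2), and at k = 0 the first is twice
    the second.  So term by term the sum is twice catalan d times the exact one,
    with relative error O(1/(k+1) + k/N + k^3/N^2) ([weight_error]).

    The relevant k are of order sqrt N, which makes this error N^(-1/2) on
    average.  To prove it, bound the terms by a multiple of
    (k + 1)^2 * 2^k * C(2n - k, n); the three errors then become the moments of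
    orders 1, 3 and 5 of the weights 2^k * C(2n - k, n), and these moments
    telescope ([moment1], [moment3_le], [moment5_le]).  Hence
      height_sum d n t = 2 * catalan d * catalan (n + t) * (1 + O(N^(-1/2)))
    ([height_sum_relative]), without any evaluation of a Gaussian sum.

    It remains to insert catalan m = 4^m / (sqrt pi * m^(3/2)) * (1 + O(1/m)),
    which comes from Wallis' product ([scaled_catalan_ge], [scaled_catalan_le],
    [catalan_product_ratio]).  Since theta > 0 and N >= 1, the error N^(-1/2)
    is at most N^(3 theta - 1/2). *)

Set Implicit Arguments.
Unset Strict Implicit.
Unset Printing Implicit Defensive.

Import Order.TTheory GRing.Theory Num.Theory.
Import numFieldNormedType.Exports.

(** * Ballot numbers *)

Local Open Scope nat_scope.

(** Lattice paths from 0 with n ups and n - k downs that stay nonnegative. The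
    recursion sorts them by the height l just before the last up step. *)
Fixpoint ballot (n k : nat) : nat :=
  if n is m.+1 then \sum_(k.-1 <= l < n) ballot m l else (k == 0).

Definition catalan n := ballot n 0.

Lemma ballot_gt n k : n < k -> ballot n k = 0.
Proof.
by case: n k => [|n] [|k] //= lt_nk; rewrite big_geq.
Qed.

Lemma ballot_diag n : ballot n n = 1.
Proof.
elim: n => //= -[|n] IHn; first by rewrite big_nat1.
by rewrite big_nat1.
Qed.

Lemma ballotS n k :
  ballot n.+1 k.+1 = ballot n k + ballot n.+1 k.+2.
Proof.
case: (ltnP k n.+1) => [lt_kn|le_nk]; first by rewrite /= big_ltn.
by rewrite !ballot_gt //; lia.
Qed.

Lemma ballot0 n : 0 < n -> ballot n 1 = catalan n.
Proof. by case: n. Qed.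

(** Last passage decomposition: a path ending at height k + 1 splits at its
    last step from height k to k + 1, and the rest is a Dyck path. The proof
    checks that both sides satisfy the local recursion [ballotS], by induction
    on t and downwards on k. *)
Lemma ballot_conv t k :
  ballot t k.+1 = \sum_(s < t) ballot s k * catalan (t - s.+1).
Proof.
elim: t k => [|t IHt] k; first by rewrite big_ord0.
(* Downward induction on k, as the recursion at k calls k + 2. *)
have [m] := ubnP (t.+1 - k); elim: m k => // m IHm k lt_m.
case: (ltnP k t.+1) => [lt_kt|le_tk]; last first.
  rewrite ballot_gt // big1 // => s _.
  by rewrite ballot_gt // (leq_trans (ltn_ord s)).
rewrite ballotS (IHm k.+1); last by lia.
rewrite [in LHS]big_ord_recl [in RHS]big_ord_recl /= mul0n add0n subn1 /=.
case: k {IHm} lt_m lt_kt => [|k] _ _; first by rewrite mul1n.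
rewrite mul0n add0n IHt -big_split /=.
by apply: eq_bigr => s _; rewrite subSS -mulnDl -ballotS.
Qed.

(** The reflection principle, proved through Pascal's rule. *)
Lemma ballot_bin n k : k <= n ->
  ballot n k + 'C(2 * n - k, n.+1) = 'C(2 * n - k, n).
Proof.
elim: n k => [|n IHn] k le_kn; first by move: le_kn; rewrite leqn0 => /eqP->.
have [m] := ubnP (n.+1 - k); elim: m k le_kn => // m IHm k le_kn lt_m.
case: (ltnP k n.+1) => [lt_kn|le_nk]; last first.
  have -> : k = n.+1 by lia.
  by rewrite ballot_diag (_ : 2 * n.+1 - n.+1 = n.+1) ?binn ?bin_small; lia.
case: k {le_kn} lt_m lt_kn => [|k] lt_m lt_kn.
  have := IHm 1 isT ltac:(lia); rewrite [ballot n.+1 1]ballot0 // /catalan.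
  have -> : 2 * n.+1 - 0 = (2 * n.+1 - 1).+1 by lia.
  (* At k = 0 the two middle entries of row 2 n + 1 agree. *)
  have sym : 'C(2 * n.+1 - 1, n) = 'C(2 * n.+1 - 1, n.+1).
    by rewrite -bin_sub; [congr 'C(_, _); lia | lia].
  by rewrite !binS sym; lia.
rewrite ballotS; have := IHm k.+2 lt_kn ltac:(lia).
have := IHn k ltac:(lia).
have -> : 2 * n.+1 - k.+2 = 2 * n - k by lia.
have -> : 2 * n.+1 - k.+1 = (2 * n - k).+1 by lia.
rewrite !binS; lia.
Qed.

Lemma catalan_conv n : catalan n.+1 = \sum_(s < n.+1) catalan s * catalan (n - s).
Proof. by rewrite -ballot0 // ballot_conv. Qed.

(** The sum over the height k at which the letter in question is pushed; see
    the comment at the top. *)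
Definition height_sum (d n t : nat) : nat :=
  \sum_(k < n.+1) catalan (d + k) * ballot n k * ballot t k.

Lemma height_sum0 d t : height_sum d 0 t = catalan d * catalan t.
Proof. by rewrite /height_sum big_ord_recl big_ord0 addn0 addn0 muln1. Qed.

(** Terms with k > n vanish, so sums for different n can share one range. *)
Lemma height_sum_widen m d n t : n < m ->
  height_sum d n t = \sum_(k < m) catalan (d + k) * ballot n k * ballot t k.
Proof.
move=> lt_nm; rewrite /height_sum -!(big_mkord predT
  (fun k => catalan (d + k) * ballot n k * ballot t k)).
rewrite [RHS](big_cat_nat _ lt_nm) //= [X in _ = _ + X]big_nat_cond.
by rewrite [X in _ + X]big1 ?addn0 // => k; rewrite andbT => /andP[lt_nk _];
   rewrite (ballot_gt lt_nk) muln0.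
Qed.

(** Split ballot n.+1 k by [ballotS], then apply [ballot_conv] to ballot n.+1
    k.+1 in one part and to ballot t k.+1 in the other. In terms of words, the
    first sum collects words whose least letter precedes the marked one, the
    second those where it follows. *)
Lemma height_sumS d n t : height_sum d n.+1 t =
  \sum_(s < n.+1) catalan (n - s) * height_sum d s t
  + \sum_(s < t) height_sum d.+1 n s * catalan (t - s.+1).
Proof.
transitivity (\sum_(k < n.+2) catalan (d + k) * ballot n.+1 k.+1 * ballot t k
   + \sum_(k < n.+1) catalan (d.+1 + k) * ballot n k * ballot t k.+1).
  rewrite /height_sum big_ord_recl [in RHS]big_ord_recl -addnA; congr (_ + _).
  rewrite -big_split; apply: eq_bigr => k _.
  by rewrite -[nat_of_ord (lift ord0 k)]/(k.+1) ballotS addnS mulnDr mulnDl addnC.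
congr (_ + _).
  under [RHS]eq_bigr => s _.
    rewrite (height_sum_widen _ _ (leq_trans (ltn_ord s) (leqnSn n.+1))) big_distrr /=; over.
  rewrite exchange_big; apply: eq_bigr => k _.
  rewrite ballot_conv big_distrr big_distrl /=; apply: eq_bigr => s _.
  by rewrite subSS; lia.
rewrite /height_sum; under [RHS]eq_bigr => s _ do rewrite big_distrl /=.
rewrite exchange_big /=; apply: eq_bigr => k _.
rewrite ballot_conv big_distrr /=; apply: eq_bigr => s _.
lia.
Qed.

(** Every Dyck path with n + t ups is cut just before its (n + 1)-st up step,
    at some height k; what follows this step, read backwards, ends at height k
    + 1. The proof moves the cut by one up step at a time. *)
Lemma ballot_cut n t : 0 < t ->
  \sum_(k < n.+1) ballot n k * ballot (t + k) k.+1 = catalan (n + t).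
Proof.
have diag u l : 0 < u ->
  \sum_(k < l.+1) ballot (u + k) k.+1 = ballot (u + l) l.
  move=> u0; elim: l => [|l IHl].
    by rewrite big_ord_recl big_ord0 !addn0 ballot0.
  by rewrite big_ord_recr IHl /= addnS -ballotS.
elim: n t => [|n IHn] t t0.
  by rewrite big_ord_recl big_ord0 /= mul1n !addn0 ballot0.
rewrite addSnnS -IHn //.
transitivity (\sum_(l < n.+1) ballot n l *
    \sum_(k < n.+2 | k < l.+2) ballot (t + k) k.+1); last first.
  apply: eq_bigr => l _.
  rewrite addSnnS -diag //.
  rewrite -(big_ord_widen n.+2 (fun k => ballot (t + k) k.+1)) //.
  exact: (ltn_ord l).
under [RHS]eq_bigr => l _ do rewrite big_distrr /=.
rewrite (exchange_big_dep predT) //=; apply: eq_bigr => k _.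
rewrite big_geq_mkord big_distrl /=; apply: eq_bigl => l.
by case: (k : nat).
Qed.

(** * Words avoiding 312 *)

(** Avoidance of 312 for words, which unlike permutations can be cut in
    pieces. *)
Definition avoids (w : seq nat) : Prop :=
  forall i1 i2 i3, i1 < i2 < i3 -> i3 < size w ->
    nth 0 w i2 < nth 0 w i3 < nth 0 w i1 -> False.

Lemma nth_cat_gt (m : nat) (u v : seq nat) i :
  size u < i -> nth 0 (u ++ m :: v) i = nth 0 v (i - (size u).+1).
Proof.
move=> lti; rewrite nth_cat ifF; last by lia.
by rewrite (_ : i - size u = (i - (size u).+1).+1) //; lia.
Qed.

Lemma nth_cat_lt (m : nat) (u v : seq nat) i :
  i < size u -> nth 0 (u ++ m :: v) i = nth 0 u i.
Proof. by move=> lti; rewrite nth_cat lti. Qed.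

(** Being least, m can only be the 1 of a pattern 312, so a pattern contained
    in neither u nor v has its 3 in u and its 2 in v, which the order
    excludes. *)
Lemma avoids_cat_min (m : nat) (u v : seq nat) :
    {in u & v, forall a c, a < c} ->
    {in u, forall a, m < a} -> {in v, forall c, m < c} ->
  avoids (u ++ m :: v) <-> avoids u /\ avoids v.
Proof.
move=> lt_uv lt_u lt_v; split=> [av|[avu avv]].
  split=> i1 i2 i3 lt123 lt3 lts.
    apply: (av i1 i2 i3 lt123); first by rewrite size_cat ltn_addr.
    by rewrite !nth_cat lt3 !ifT ?lts //; lia.
  apply: (av ((size u).+1 + i1) ((size u).+1 + i2) ((size u).+1 + i3)).
  - lia.
  - by rewrite size_cat /=; lia.
  have nthE i : nth 0 (u ++ m :: v) ((size u).+1 + i) = nth 0 v i.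
    rewrite nth_cat ifF; last by lia.
    by rewrite (_ : _ - _ = i.+1) //; lia.
  by rewrite !nthE.
move=> i1 i2 i3 lt123; rewrite size_cat /= => lt3.
have nthm : nth 0 (u ++ m :: v) (size u) = m by rewrite nth_cat ltnn subnn.
case: (ssrnat.ltngtP i3 (size u)) => [lt3u|gt3u|eq3].
- by rewrite !nth_cat_lt; [move=> lts; apply: (avu _ _ _ _ _ lts) | ..]; lia.
- case: (ssrnat.ltngtP i1 (size u)) => [lt1u|gt1u|->].
  + rewrite (nth_cat_lt _ _ lt1u) (nth_cat_gt _ _ gt3u) => /andP[_].
    have in_u : nth 0 u i1 \in u by rewrite mem_nth.
    have lt3v : i3 - (size u).+1 < size v by lia.
    have in_v := mem_nth 0 lt3v.
    by rewrite ltnNge ltnW ?lt_uv.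
  + by rewrite !nth_cat_gt; [move=> lts; apply: (avv _ _ _ _ _ lts) | ..]; lia.
  + rewrite nthm (nth_cat_gt _ _ gt3u) => /andP[_].
    have lt3v : i3 - (size u).+1 < size v by lia.
    by rewrite ltnNge ltnW ?lt_v ?mem_nth.
- have lt2u : i2 < size u by lia.
  rewrite eq3 nthm (nth_cat_lt _ _ lt2u) => /andP[+ _].
  have in_u : nth 0 u i2 \in u by rewrite mem_nth.
  by rewrite ltnNge ltnW ?lt_u.
Qed.

(** If all letters of u are smaller than those of v, then sorting u ++ v sorts
    u and v separately, so both are permutations of intervals. *)
Lemma perm_iota_split (m N : nat) (u v : seq nat) :
    {in u & v, forall a c, a < c} -> perm_eq (u ++ v) (iota m N) ->
  [/\ size u + size v = N, perm_eq u (iota m (size u)) &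
      perm_eq v (iota (m + size u) (size v))].
Proof.
move=> lt_uv Puv.
have eqN : size u + size v = N by rewrite -size_cat (perm_size Puv) size_iota.
have : sort leq u ++ sort leq v = iota m (size u) ++ iota (m + size u) (size v).
  rewrite -iotaD eqN; apply/(sorted_eq leq_trans anti_leq).
  - rewrite (sorted_pairwise leq_trans) pairwise_cat.
    rewrite -!(sorted_pairwise leq_trans) !sort_sorted ?andbT; try exact: leq_total.
    by apply/allrelP => a c; rewrite !mem_sort => au cv; exact/ltnW/lt_uv.
  - exact: iota_sorted.
  - rewrite -(permPr Puv).
    by apply: perm_cat; rewrite perm_sort.
move/eqP; rewrite eqseq_cat ?size_sort ?size_iota // => /andP[/eqP<- /eqP<-].
by rewrite perm_sym perm_sort perm_sym perm_sort.
Qed.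

(** The 312-avoiding arrangements of m, ..., m + N - 1, listed by the number p
    of letters before the least one. The argument h bounds the recursion
    depth; the list is complete when N <= h. *)
Fixpoint words (h m N : nat) : seq (seq nat) :=
  match h, N with
  | h.+1, N.+1 =>
      [seq uv.1 ++ m :: uv.2 | p <- iota 0 N.+1,
         uv <- [seq (u, v) | u <- words h m.+1 p,
                             v <- words h (m.+1 + p) (N - p)]]
  | _, _ => [:: [::]]
  end.

(** The least letter m of an avoiding word w = u ++ m :: v can play the role
    of the 1 in 312 with any letter of u and any letter of v: hence u < v. *)
Lemma mem_words h m N w : N <= h ->
  w \in words h m N <-> perm_eq w (iota m N) /\ avoids w.
Proof.
elim: h m N w => [|h IHh] m [|N] w // le_Nh.
- rewrite inE; split=> [/eqP->|[]]; first by split=> // i1 i2 i3 _.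
  by move/perm_nilP->.
- rewrite inE; split=> [/eqP->|[]]; first by split=> // i1 i2 i3 _.
  by move/perm_nilP->.
rewrite ltnS in le_Nh; split.
  case/allpairsPdep=> p [[_ _] [lep /allpairsP[[u v] /= [wu wv [-> ->]]] ->]].
  have lepN : p <= N by move: lep; rewrite mem_iota; lia.
  move/(IHh _ _ _ (leq_trans lepN le_Nh)): wu => [Pu avu].
  move/(IHh _ _ _ (leq_trans (leq_subr p N) le_Nh)): wv => [Pv avv].
  split.
    rewrite perm_catC cat_cons /= perm_cons.
    rewrite (permPl (permEl (perm_catC _ _))).
    by rewrite -[X in iota _ X](subnKC lepN) iotaD perm_cat.
  by apply/avoids_cat_min => // [a c|a|c];
     rewrite ?(perm_mem Pu) ?(perm_mem Pv) !mem_iota; lia.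
move=> [Pw avw].
have mw : m \in w by rewrite (perm_mem Pw) mem_head.
have [u [v eqw]] : exists u v : seq nat, w = u ++ m :: v.
  by case/splitPr: mw => u v; exists u, v.
move: Pw avw; rewrite {w mw}eqw.
rewrite perm_catC cat_cons perm_cons.
rewrite (permPl (permEl (perm_catC _ _))) => Puv avw.
have gt_m a : a \in u ++ v -> m < a by rewrite (perm_mem Puv) mem_iota; lia.
have gt_u a : a \in u -> m < a by move=> au; apply: gt_m; rewrite mem_cat au.
have gt_v a : a \in v -> m < a by move=> av; apply: gt_m; rewrite mem_cat av orbT.
have lt_uv : {in u & v, forall a c, a < c}.
  move=> a c au cv; rewrite ltnNge leq_eqVlt; apply/negP => /orP[/eqP eq_ac|lt_ca].
    have := perm_uniq Puv; rewrite iota_uniq cat_uniq => /and3P[_ /hasP[]].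
    by exists a; rewrite // -eq_ac.
  pose i := index a u; pose k := (size u).+1 + index c v.
  have lti : i < size u by rewrite index_mem.
  have ltk : index c v < size v by rewrite index_mem.
  apply: (avw i (size u) k); first by rewrite /k; lia.
    by rewrite size_cat /k addSnnS ltn_add2l ltnS.
  rewrite !nth_cat lti ltnn subnn ifF; last by rewrite /k; lia.
  rewrite (_ : k - size u = (index c v).+1) /=; last by rewrite /k; lia.
  by rewrite !nth_index // gt_v.
have [avu avv] := (avoids_cat_min lt_uv gt_u gt_v).1 avw.
have [eqN Pu Pv] := perm_iota_split lt_uv Puv.
apply/allpairsPdep; exists (size u), (u, v); split=> //.
  by rewrite mem_iota; lia.
apply/allpairsP; exists (u, v); split=> //=.
  by apply/IHh => //; lia.
rewrite (_ : N - size u = size v); last by lia.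
by apply/IHh => //; lia.
Qed.

Lemma words_uniq h m N : N <= h -> uniq (words h m N).
Proof.
elim: h m N => [|h IHh] m [|N] //; rewrite ltnS => le_Nh.
pose wd p := [seq (u, v) | u <- words h m.+1 p, v <- words h (m.+1 + p) (N - p)].
apply: (@allpairs_uniq_dep nat (fun=> (seq nat * seq nat)%type) _
  (fun _ uv => uv.1 ++ m :: uv.2) (iota 0 N.+1) wd); first exact: iota_uniq.
  move=> p; rewrite mem_iota => lep; have lepN : p <= N by lia.
  apply: allpairs_uniq => [||[? ?] [? ?] _ _ [-> ->] //]; apply: IHh; lia.
have wf x : x \in [seq existT (fun=> (seq nat * seq nat)%type) p y | p <- iota 0 N.+1, y <- wd p] ->
    size (tagged x).1 = tag x /\ m \notin (tagged x).1.
  case/allpairsPdep=> p [y [+ /allpairsP[[u v] /= [wu wv ->]] ->]] /=.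
  rewrite mem_iota => lep; have lepN : p <= N by lia.
  have [Pu _] := (mem_words _ _ (leq_trans lepN le_Nh)).1 wu.
  split; first by rewrite (perm_size Pu) size_iota.
  by rewrite (perm_mem Pu) mem_iota ltnn.
move=> [p1 [u1 v1]] [p2 [u2 v2]] /wf[/= <- u1m] /wf[/= <- u2m] eq12.
have := congr1 (index m) eq12.
rewrite !index_cat (negPf u1m) (negPf u2m) /= eqxx !addn0 => eqs.
by move/eqP: eq12; rewrite eqseq_cat // eqseq_cons eqxx => /andP[/eqP-> /eqP->].
Qed.

Lemma count_allpairs_l (A B C : eqType) (P : pred C) (Q : pred A)
    (f : A -> B -> C) (s : seq A) (t : seq B) :
  {in s & t, forall a b, P (f a b) = Q a} ->
  count P [seq f a b | a <- s, b <- t] = count Q s * size t.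
Proof.
elim: s => //= a s IHs PQ.
rewrite count_cat IHs => [|x y xs yt]; last by apply: PQ; rewrite ?inE ?xs ?orbT.
rewrite count_map mulnDl; congr (_ + _).
rewrite (eq_in_count (a2 := fun=> Q a)) => [|b bt]; last exact: PQ (mem_head _ _) bt.
by case: (Q a); rewrite ?count_pred0 ?count_predT ?mul1n.
Qed.

Lemma count_allpairs_r (A B C : eqType) (P : pred C) (Q : pred B)
    (f : A -> B -> C) (s : seq A) (t : seq B) :
  {in s & t, forall a b, P (f a b) = Q b} ->
  count P [seq f a b | a <- s, b <- t] = size s * count Q t.
Proof.
elim: s => //= a s IHs PQ.
rewrite count_cat IHs => [|x y xs yt]; last by apply: PQ; rewrite ?inE ?xs ?orbT.
rewrite count_map mulSn; congr (_ + _).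
by apply: eq_in_count => b bt; exact: PQ (mem_head _ _) bt.
Qed.

Lemma count_wordsS (P : pred (seq nat)) h m N :
  count P (words h.+1 m N.+1) = \sum_(p < N.+1)
    count (fun uv => P (uv.1 ++ m :: uv.2))
      [seq (u, v) | u <- words h m.+1 p, v <- words h (m.+1 + p) (N - p)].
Proof.
rewrite (_ : words h.+1 m N.+1 = flatten [seq
    [seq uv.1 ++ m :: uv.2 | uv <- [seq (u, v) | u <- words h m.+1 p,
       v <- words h (m.+1 + p) (N - p)]] | p <- iota 0 N.+1]) //.
rewrite count_flatten sumnE -map_comp big_map.
rewrite -[iota 0 N.+1]/(index_iota 0 N.+1) big_mkord.
by apply: eq_bigr => p _ /=; rewrite count_map.
Qed.

Lemma size_words h m N : N <= h -> size (words h m N) = catalan N.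
Proof.
elim: h m N => [|h IHh] m [|N] //; rewrite ltnS => le_Nh.
rewrite -count_predT count_wordsS catalan_conv.
apply: eq_bigr => p _ /=; have := ltn_ord p; rewrite ltnS => lepN.
by rewrite count_predT size_allpairs !IHh //; lia.
Qed.

(** Counts avoiding words with value m + n in position d + n, with values and
    positions from 0. Three cases for the number p of letters before the least
    letter: for p < d + n the marked letter lies in v, for p = d + n it is the
    least letter itself, which forces n = 0, for p > d + n it lies in u. The
    result matches [height_sumS]. *)
Lemma count_words h m N d n t : N <= h -> N = (d + n + t).+1 ->
  count (fun w => nth 0 w (d + n) == m + n) (words h m N) = height_sum d n t.
Proof.
elim: h m N d n t => [|h IHh] m [|N] d n t //; rewrite ltnS => le_Nh [eqN].
pose cnt p := count
  (fun uv : seq nat * seq nat => nth 0 (uv.1 ++ m :: uv.2) (d + n) == m + n)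
  [seq (u, v) | u <- words h m.+1 p, v <- words h (m.+1 + p) (N - p)].
have -> : count (fun w => nth 0 w (d + n) == m + n) (words h.+1 m N.+1)
          = \sum_(0 <= p < N.+1) cnt p.
  by rewrite count_wordsS big_mkord.
have wu p u : p <= N -> u \in words h m.+1 p ->
    size u = p /\ forall i, i < p -> m < nth 0 u i.
  move=> lepN /(mem_words _ _ (leq_trans lepN le_Nh)) [Pu _].
  rewrite (perm_size Pu) size_iota; split=> // i lti.
  have : nth 0 u i \in u by rewrite mem_nth // (perm_size Pu) size_iota.
  by rewrite (perm_mem Pu) mem_iota; lia.
have wv p v : p <= N -> v \in words h (m.+1 + p) (N - p) ->
    size v = N - p /\ forall i, i < N - p -> m + p < nth 0 v i.
  move=> lepN /(mem_words _ _ (leq_trans (leq_subr p N) le_Nh)) [Pv _].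
  rewrite (perm_size Pv) size_iota; split=> // i lti.
  have : nth 0 v i \in v by rewrite mem_nth // (perm_size Pv) size_iota.
  by rewrite (perm_mem Pv) mem_iota; lia.
have cnt_lt p : p < d + n -> cnt p = if p < n then
    catalan p * height_sum d (n - p.+1) t else 0.
  move=> ltp; have lepN : p <= N by lia.
  rewrite /cnt (count_allpairs_r
    (Q := fun v => nth 0 v (d + n - p.+1) == m + n)) => [|u v uin vin].
    case: ltnP => [ltpn|lepn].
      rewrite size_words; last by lia.
      rewrite -(IHh (m.+1 + p) (N - p) d (n - p.+1) t); try lia.
      congr (_ * _); apply: eq_count => v /=.
      by congr (nth 0 v _ == _); lia.
    rewrite (_ : count _ _ = 0) ?muln0 //; apply/eqP.
    rewrite -leqn0 leqNgt -has_count; apply/hasPn => v /(wv _ _ lepN)[_ vgt].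
    have := vgt (d + n - p.+1) ltac:(lia); lia.
  have [su _] := wu _ _ lepN uin.
  rewrite /= nth_cat su ifF; last by lia.
  by rewrite (_ : d + n - p = (d + n - p.+1).+1) //; lia.
have cnt_eq : cnt (d + n) = if n == 0 then catalan d * catalan t else 0.
  have lepN : d + n <= N by lia.
  rewrite /cnt (count_allpairs_r (Q := fun=> n == 0)) => [|u v uin vin].
    case: eqP => [n0|_]; last by rewrite count_pred0 muln0.
    by rewrite count_predT !size_words; [congr (catalan _ * catalan _)|..]; lia.
  have [su _] := wu _ _ lepN uin.
  by rewrite /= nth_cat su ltnn subnn /=; lia.
have cnt_gt p : d + n < p <= N -> cnt p = if n is n'.+1 then
    height_sum d.+1 n' (p - (d + n).+1) * catalan (N - p) else 0.
  move=> /andP[ltp lepN].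
  rewrite /cnt (count_allpairs_l
    (Q := fun u => nth 0 u (d + n) == m + n)) => [|u v uin vin].
    case: n {cnt cnt_lt cnt_eq} eqN ltp => [|n] eqN ltp.
      rewrite (_ : count _ _ = 0) ?muln0 //; apply/eqP.
      rewrite -leqn0 leqNgt -has_count; apply/hasPn => u /(wu _ _ lepN)[_ ugt].
      have := ugt (d + 0) ltac:(lia); lia.
    rewrite size_words; last by lia.
    rewrite -(IHh m.+1 p d.+1 n (p - (d + n.+1).+1)); try lia.
    congr (_ * _); apply: eq_count => u /=.
    by rewrite addSnnS addSnnS.
  have [su _] := wu _ _ lepN uin.
  by rewrite /= nth_cat su ltp.
rewrite (big_cat_nat (n := d + n)) //=; last by lia.
rewrite [X in _ + X]big_ltn; last by lia.
rewrite cnt_eq; clearbody cnt.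
case: n cnt_lt cnt_gt {cnt_eq} eqN => [|n] cnt_lt cnt_gt eqN.
  rewrite big_nat_cond big1 => [|p]; last by rewrite andbT => /andP[_ /cnt_lt].
  rewrite big_nat_cond big1 => [|p]; last by rewrite andbT => /andP[? ?]; apply: cnt_gt; lia.
  by rewrite height_sum0 addn0.
rewrite add0n height_sumS; congr (_ + _).
  rewrite (big_cat_nat (n := n.+1)) //=; last by lia.
  rewrite [X in _ + X]big_nat_cond [X in _ + X]big1 => [|p]; last first.
    by rewrite andbT => /andP[? ?]; rewrite cnt_lt // ltnNge ifN //; lia.
  rewrite addn0 big_mkord (reindex_inj rev_ord_inj) /=.
  apply: eq_bigr => s _; have := ltn_ord s; rewrite subSS => lts.
  by rewrite cnt_lt ?ifT; try lia; congr (_ * height_sum _ _ _); lia.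
rewrite -{1}[(d + n.+1).+1]add0n big_addn big_mkord.
rewrite (_ : N.+1 - _ = t); last by lia.
apply: eq_bigr => s _; have := ltn_ord s => lts.
rewrite cnt_gt; last by lia.
by congr (height_sum _ _ _ * catalan _); lia.
Qed.

(** * From permutations to words *)

Definition word N (s : 'S_N) : seq nat := [seq val (s i) | i <- enum 'I_N].

Lemma size_word N (s : 'S_N) : size (word s) = N.
Proof. by rewrite size_map size_enum_ord. Qed.

Lemma nth_word N (s : 'S_N) (i : 'I_N) : nth 0 (word s) i = s i.
Proof. by rewrite (nth_map i) ?size_enum_ord // nth_ord_enum. Qed.

Lemma word_inj N : injective (@word N).
Proof.
move=> s1 s2 eq12; apply/permP => i; apply: val_inj.
by rewrite /= -!nth_word eq12.
Qed.

Lemma word_perm N (s : 'S_N) : perm_eq (word s) (iota 0 N).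
Proof.
have Us : uniq (word s).
  by rewrite map_inj_uniq ?enum_uniq // => i j /val_inj/perm_inj.
apply: uniq_perm => //; first exact: iota_uniq.
have sub : {subset word s <= iota 0 N}.
  by move=> _ /mapP[i _ ->]; rewrite mem_iota /= add0n.
by have [] := uniq_min_size Us sub; rewrite ?size_iota ?size_word.
Qed.

Lemma avoids_word N (s : 'S_N) : reflect (avoids (word s)) (avoids312 s).
Proof.
apply: (iffP idP) => [avs i1 i2 i3|avw].
  rewrite size_word => /andP[lt12 lt23] lt3 lts; case/negP: avs.
  have lt2 := ltn_trans lt23 lt3; have lt1 := ltn_trans lt12 lt2.
  apply/existsP; exists (Ordinal lt1); apply/existsP; exists (Ordinal lt2).
  apply/existsP; exists (Ordinal lt3); rewrite -!nth_word lt12 lt23.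
  by case/andP: lts => -> ->.
apply/negP => /existsP[i1 /existsP[i2 /existsP[i3]]].
rewrite -!nth_word => /and4P[lt12 lt23 lt31 lt23'].
by apply: (avw i1 i2 i3); rewrite ?lt12 ?lt23' ?size_word.
Qed.

Lemma word_surj N (w : seq nat) :
  perm_eq w (iota 0 N) -> exists s : 'S_N, word s = w.
Proof.
move=> Pw; have sw : size w = N by rewrite (perm_size Pw) size_iota.
have Uw : uniq w by rewrite (perm_uniq Pw) iota_uniq.
have ltw (i : 'I_N) : nth 0 w i < N.
  have : nth 0 w i \in w by rewrite mem_nth ?sw.
  by rewrite (perm_mem Pw) mem_iota.
have inj_w : injective (fun i => Ordinal (ltw i)).
  move=> i j /(congr1 val) /= /eqP; rewrite nth_uniq ?sw // => /eqP.
  exact: val_inj.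
exists (perm inj_w); apply: (@eq_from_nth _ 0); rewrite size_word ?sw // => i lti.
by rewrite (nth_word _ (Ordinal lti)) permE.
Qed.

(** Counting permutations amounts to counting words, since [word] is a
    bijection onto the arrangements of 0, ..., N - 1. *)
Lemma card_S312 N (Q : pred (seq nat)) :
  #|[set s : S312 N | Q (word (val s))]| = count Q (words N 0 N).
Proof.
rewrite cardE -(size_map (@word N \o val)) -size_filter.
apply/perm_size/uniq_perm.
- by rewrite map_inj_uniq ?enum_uniq //; apply: inj_comp val_inj; exact: word_inj.
- by rewrite filter_uniq ?words_uniq.
move=> w; rewrite mem_filter; apply/mapP/andP => [[s]|[Qw /mem_words[]//]].
  rewrite mem_enum inE => Qs ->; split=> //=; apply/mem_words => //.
  by split; [exact: word_perm | exact/avoids_word/valP].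
move=> /word_surj[s ws] avw.
have avs : avoids312 s by apply/avoids_word; rewrite ws.
by exists (Sub s avs); rewrite ?mem_enum ?inE /= ?SubK ws.
Qed.

Lemma card_S312T N : #|S312 N| = catalan N.
Proof.
rewrite -cardsT -(size_words 0 (leqnn N)) -count_predT -card_S312.
by congr #|pred_of_set _|; apply/setP => s; rewrite !inE.
Qed.

Lemma card_Sbullet N t j : 0 < j < N - t ->
  #|Sbullet N (N - t) j| = height_sum (N - t - j) j.-1 t.
Proof.
move=> /andP[j0 ltj].
rewrite -(@count_words N 0 N) //; last by lia.
rewrite -(card_S312 N (fun w => nth 0 w _ == _)).
congr #|pred_of_set _|; apply/setP => s; rewrite !inE add0n.
have ltiN : N - t - j + j.-1 < N by lia.
apply/existsP/eqP => [[k /andP[/eqP ek /eqP ej]]|eqj].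
  rewrite (_ : N - t - j + j.-1 = k); last by lia.
  by rewrite nth_word -ej.
exists (Ordinal ltiN); rewrite -(nth_word _ (Ordinal ltiN)) /= eqj; lia.
Qed.

(** * Catalan numbers and Wallis' product *)

Local Open Scope ring_scope.

(** The primitive of the n-th power of cos that vanishes at 0, built from the
    reduction formula; its value at pi / 2 is the n-th Wallis integral. *)
Fixpoint cos_primitive {R : realType} (n : nat) : R -> R :=
  match n with
  | 0 => id
  | 1 => sin
  | (p.+1 as q).+1 => p.+2%:R^-1 *:
      (sin * cos ^+ p.+1 + p.+1%:R *: cos_primitive p)
  end.

Lemma cos_primitiveP (R : realType) n (x : R) :
  is_derive x 1 (cos_primitive n) (cos x ^+ n).
Proof.
have [m] := ubnP n; elim: m n => // m IHm [|[|n]] lt_nm.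
- exact: is_derive_id.
- by rewrite expr1; exact: is_derive_sin.
have dn : is_derive x 1 (cos_primitive n) (cos x ^+ n) by apply: IHm; lia.
have dX : is_derive x 1 (cos ^+ n.+1) ((n.+1%:R * cos x ^+ n) *: - sin x).
  exact: is_deriveX.
have dM := is_deriveM (is_derive_sin x) dX.
have := is_deriveZ n.+2%:R^-1 (is_deriveD dM (is_deriveZ n.+1%:R dn)).
move/is_derive_eq; apply.
have := cos2Dsin2 x; rewrite /GRing.scale /= => cs.
have -> : sin x * (n.+1%:R * cos x ^+ n * - sin x)
  = n.+1%:R * cos x ^+ n * (cos x ^+ 2 - 1) by rewrite -cs; ring.
rewrite exprfctE !exprS -[n.+2%:R]natr1.
have n1 : n.+1%:R + 1 != 0 :> R by rewrite natr1 pnatr_eq0.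
by field.
Qed.

(** The difference of the two primitives has derivative cos^n * (1 - cos) >= 0
    on the interval. *)
Lemma cos_primitive_le (R : realType) n :
  @cos_primitive R n.+1 (pi / 2) <= cos_primitive n (pi / 2).
Proof.
pose f : R -> R := cos_primitive n - cos_primitive n.+1.
have df (x : R) : is_derive x 1 f (cos x ^+ n - cos x ^+ n.+1).
  by apply: is_deriveB; exact: cos_primitiveP.
have p0 m : @cos_primitive R m 0 = 0.
  have [k] := ubnP m; elim: k m => // k IHk [|[|m]] lt_mk //; first exact: sin0.
  rewrite /= !fctE sin0 mul0r IHk ?scaler0 ?addr0 ?scaler0 //; lia.
suff : f 0 <= f (pi / 2) by rewrite /f !fctE !p0 subrr subr_ge0.
have pi0 : 0 <= pi / 2 :> R by rewrite divr_ge0 ?pi_ge0.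
apply: (@ger0_derive1_ndecr _ f 0 (pi / 2)) => // [x|].
- rewrite in_itv /= => /andP[x0 xpi].
  have [_ ] := df x; rewrite derive1E => ->.
  have c0 : 0 <= cos x by apply: cos_ge0_pihalf; apply/andP; split; lra.
  by rewrite exprS -{1}[cos x ^+ n]mul1r -mulrBl mulr_ge0 ?subr_ge0 ?exprn_ge0 ?cos_le1.
- apply: derivable_within_continuous => x _.
  by have := df x => -[].
Qed.

Definition wallis (R : realType) n : R := cos_primitive n (pi / 2).

Lemma wallisS2 (R : realType) n :
  n.+2%:R * wallis R n.+2 = n.+1%:R * wallis R n.
Proof.
rewrite /wallis /= !fctE cos_pihalf exprS mul0r mulr0 add0r.
by rewrite /GRing.scale /= mulVKf ?pnatr_eq0.
Qed.

Definition scaled_binomial (R : realType) m : R := 'C(2 * m, m)%:R / 4 ^+ m.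

Lemma scaled_binomial_gt0 (R : realType) m : 0 < scaled_binomial R m.
Proof. by rewrite divr_gt0 ?exprn_gt0 // ltr0n bin_gt0; lia. Qed.

Lemma scaled_binomialS (R : realType) m :
  (2 * m.+1)%:R * scaled_binomial R m.+1 = (2 * m).+1%:R * scaled_binomial R m.
Proof.
have eqn : (m.+1 * 'C(2 * m.+1, m.+1) = 2 * (2 * m).+1 * 'C(2 * m, m))%N.
  have := mul_bin_diag (2 * m.+1) m; have := mul_bin_down (2 * m).+1 m.
  have -> : ((2 * m.+1).-1 = (2 * m).+1)%N by lia.
  have -> : ((2 * m).+1 - m = m.+1)%N by lia.
  rewrite /=; nia.
have := congr1 (fun n : nat => n%:R : R) eqn.
rewrite /scaled_binomial !natrM exprS => e.
have h4 : 4 ^+ m != 0 :> R by rewrite expf_neq0.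
transitivity (m.+1%:R * 'C(2 * m.+1, m.+1)%:R / (2 * 4 ^+ m) : R).
  by field; rewrite h4.
by rewrite e; field; rewrite h4.
Qed.

Lemma wallis_even (R : realType) m : wallis R (2 * m) = pi / 2 * scaled_binomial R m.
Proof.
elim: m => [|m IHm]; first by rewrite /scaled_binomial muln0 bin0 expr0 divr1 mulr1.
have p : (2 * m.+1)%:R != 0 :> R by rewrite pnatr_eq0.
apply: (mulfI p); rewrite mulrCA scaled_binomialS mulrCA -IHm.
by rewrite mulnS wallisS2.
Qed.

Lemma wallis_odd (R : realType) m :
  wallis R (2 * m).+1 * ((2 * m).+1%:R * scaled_binomial R m) = 1.
Proof.
elim: m => [|m IHm].
  by rewrite /scaled_binomial /wallis muln0 bin0 expr0 divr1 mulr1 /= sin_pihalf mul1r.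
have eqm : (2 * m.+1 = (2 * m).+2)%N by lia.
transitivity ((2 * m).+3%:R * wallis R (2 * m).+3 * scaled_binomial R m.+1).
  by rewrite eqm mulrA [wallis _ _ * _]mulrC.
rewrite wallisS2 -eqm [_ * wallis _ _]mulrC -mulrA scaled_binomialS; exact: IHm.
Qed.

(** The odd Wallis integral is at most the preceding even one. *)
Lemma scaled_binomial_sqr_ge (R : realType) m : 1 <= pi * (m%:R + 1 / 2) * scaled_binomial R m ^+ 2.
Proof.
have := cos_primitive_le R (2 * m); rewrite -/(wallis R _) -/(wallis R _).
have b0 : 0 <= (2 * m).+1%:R * scaled_binomial R m by rewrite mulr_ge0 // ltW // scaled_binomial_gt0.
move/(ler_wpM2r b0); rewrite wallis_odd wallis_even => /le_trans; apply.
by rewrite -[(2 * m).+1%:R]natr1 natrM; rewrite le_eqVlt; apply/orP; left; apply/eqP; field.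
Qed.

(** The even Wallis integral is at most the preceding odd one. *)
Lemma scaled_binomial_sqr_le (R : realType) m : pi * m%:R * scaled_binomial R m ^+ 2 <= 1.
Proof.
case: m => [|m]; first by rewrite mulr0 mul0r.
have := cos_primitive_le R (2 * m).+1; rewrite -/(wallis R _) -/(wallis R _).
have b0 : 0 <= (2 * m).+1%:R * scaled_binomial R m by rewrite mulr_ge0 // ltW // scaled_binomial_gt0.
move/(ler_wpM2r b0); rewrite wallis_odd; apply: le_trans.
have := wallis_even R m.+1; rewrite mulnS => ->.
by rewrite -scaled_binomialS natrM expr2; rewrite le_eqVlt; apply/orP; left; apply/eqP; field.
Qed.

Lemma catalan_bin m : (m.+1 * catalan m = 'C(2 * m, m))%N.
Proof.
have := @ballot_bin m 0 (leq0n _); rewrite subn0 -/(catalan m).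
have := mul_bin_left (2 * m) m; have -> : (2 * m - m = m)%N by lia.
nia.
Qed.

Definition pow32 (R : realType) (x : R) : R := x * Num.sqrt x.

(** Asymptotic to m^(-3/2); the next lemmas enclose it between the values of
    this power at m + 1 and m. *)
Definition scaled_catalan (R : realType) m : R := Num.sqrt pi * (catalan m)%:R / 4 ^+ m.

Lemma scaled_catalanE (R : realType) m : scaled_catalan R m = Num.sqrt pi * scaled_binomial R m / m.+1%:R.
Proof.
rewrite /scaled_catalan /scaled_binomial -catalan_bin natrM; field.
by rewrite expf_neq0 //= addrC natr1 pnatr_eq0.
Qed.

Lemma scaled_catalan_ge (R : realType) m : 1 <= scaled_catalan R m * pow32 m.+1%:R.
Proof.
have m1 : m.+1%:R != 0 :> R by rewrite pnatr_eq0.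
have -> : scaled_catalan R m * pow32 m.+1%:R = Num.sqrt (pi * m.+1%:R * scaled_binomial R m ^+ 2).
  rewrite sqrtrM ?mulr_ge0 ?pi_ge0 // sqrtrM ?pi_ge0 // sqrtr_sqr.
  rewrite ger0_norm ?ltW ?scaled_binomial_gt0 // scaled_catalanE /pow32; field.
  by rewrite addrC natr1.
rewrite -[leLHS]sqrtr1 ler_wsqrtr //; apply: le_trans (scaled_binomial_sqr_ge R m) _.
rewrite ler_wpM2r ?sqr_ge0 // ler_wpM2l ?pi_ge0 // -[m.+1%:R]natr1; lra.
Qed.

Lemma scaled_catalan_le (R : realType) m : scaled_catalan R m * pow32 m%:R <= 1.
Proof.
have c0 : 0 <= scaled_binomial R m by rewrite ltW ?scaled_binomial_gt0.
have -> : scaled_catalan R m * pow32 m%:R =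
    m%:R / m.+1%:R * Num.sqrt (pi * m%:R * scaled_binomial R m ^+ 2).
  rewrite sqrtrM ?mulr_ge0 ?pi_ge0 // sqrtrM ?pi_ge0 // sqrtr_sqr.
  rewrite ger0_norm // scaled_catalanE /pow32; field.
  by rewrite addrC natr1 pnatr_eq0.
apply: mulr_ile1; rewrite ?divr_ge0 ?sqrtr_ge0 //.
  by rewrite ler_pdivrMr ?ltr0n // mul1r ler_nat.
by rewrite -[leRHS]sqrtr1 ler_wsqrtr // scaled_binomial_sqr_le.
Qed.

(** * Moments of the matchbox weights *)

(** The closed form of the ballot numbers, from the difference in
    [ballot_bin]. *)
Lemma ballotE n k : (k <= n)%N -> (n.+1 * ballot n k = k.+1 * 'C(2 * n - k, n))%N.
Proof.
move=> le_kn; have := ballot_bin le_kn.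
have := mul_bin_left (2 * n - k) n.
have -> : (2 * n - k - n = n - k)%N by lia.
nia.
Qed.

(** Up to the factor 4^n, the law of the number of matches left in Banach's
    matchbox problem. *)
Definition matchbox (R : realType) n k : R := 2 ^+ k * 'C(2 * n - k, n)%:R.

Lemma matchbox_ge0 (R : realType) n k : 0 <= matchbox R n k.
Proof. by rewrite mulr_ge0 ?exprn_ge0. Qed.

Lemma matchboxS (R : realType) n k : (k <= n)%N ->
  (2 * n%:R - k%:R) * matchbox R n k.+1 = 2 * (n%:R - k%:R) * matchbox R n k.
Proof.
move=> le_kn; have := mul_bin_down (2 * n - k) n.
have -> : (2 * n - k - n = n - k)%N by lia.
have -> : ((2 * n - k).-1 = 2 * n - k.+1)%N by lia.
move/(congr1 (fun m : nat => m%:R : R)); rewrite !natrM !natrB; try lia.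
rewrite natrM /matchbox exprS => e.
transitivity (2 * 2 ^+ k * ((2 * n%:R - k%:R) * 'C(2 * n - k.+1, n)%:R) : R).
  by ring.
by rewrite e; ring.
Qed.

(** Summation by parts against the recursion [matchboxS]. For polynomial F it
    relates the moments of the weights to each other. *)
Lemma matchbox_telescope (R : realType) n (F : nat -> R) :
  \sum_(k < n.+1) matchbox R n k *
     (F k * (2 * n%:R + 1 - k%:R) - F k.+1 * (2 * n%:R - 2 * k%:R)) =
  F 0%N * (2 * n%:R + 1) * 'C(2 * n, n)%:R.
Proof.
pose G k : R := F k * (2 * n%:R + 1 - k%:R) * matchbox R n k.
have GS k : (k <= n)%N ->
    G k.+1 = F k.+1 * (2 * n%:R - 2 * k%:R) * matchbox R n k.
  move=> le_kn; rewrite /G -[k.+1%:R]natr1.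
  have -> : 2 * n%:R + 1 - (k%:R + 1) = 2 * n%:R - k%:R :> R by ring.
  by rewrite -mulrA matchboxS //; ring.
rewrite -(big_mkord predT (fun k => matchbox R n k *
  (F k * (2 * n%:R + 1 - k%:R) - F k.+1 * (2 * n%:R - 2 * k%:R)))).
rewrite (telescope_sumr_eq (fun k => - G k)) // => [|k /andP[_ lt_kn]].
  by rewrite GS // subrr mulr0 mul0r oppr0 sub0r opprK /G /matchbox subr0 subn0 mul1r.
by rewrite GS // /G; ring.
Qed.

Definition moment (R : realType) p n : R :=
  \sum_(k < n.+1) k.+1%:R ^+ p * matchbox R n k.

Lemma moment1 (R : realType) n :
  moment R 1 n = (2 * n%:R + 1) * 'C(2 * n, n)%:R.
Proof.
have := matchbox_telescope n (fun=> 1 : R); rewrite mul1r => <-.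
by apply: eq_bigr => k _; rewrite -[k.+1%:R]natr1; ring.
Qed.

(** Take F k = k^2 in [matchbox_telescope]: with y = k + 1 the summand is y^3
    - (4 n + 5) y plus a nonnegative polynomial. *)
Lemma moment3_le (R : realType) n :
  moment R 3 n <= (4 * n%:R + 5) * moment R 1 n.
Proof.
have := matchbox_telescope n (fun k => k%:R ^+ 2 : R).
rewrite expr0n /= !mul0r => eq0; rewrite -subr_le0 -[leRHS]eq0.
rewrite /moment mulr_sumr -sumrB; apply: ler_sum => k _.
rewrite mulrA -mulrBl mulrC ler_wpM2l ?matchbox_ge0 // -[k.+1%:R]natr1.
have k0 : 0 <= (k : nat)%:R :> R by [].
have n0 : 0 <= n%:R :> R by [].
move: n%:R (k : nat)%:R n0 k0 => x z x0 z0; nra.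
Qed.

(** As for [moment3_le], with F k = k^4. *)
Lemma moment5_le (R : realType) n :
  moment R 5 n <= (8 * n%:R + 15) * moment R 3 n.
Proof.
have := matchbox_telescope n (fun k => k%:R ^+ 4 : R).
rewrite expr0n /= !mul0r => eq0; rewrite -subr_le0 -[leRHS]eq0.
rewrite /moment mulr_sumr -sumrB; apply: ler_sum => k _.
rewrite mulrA -mulrBl mulrC ler_wpM2l ?matchbox_ge0 // -[k.+1%:R]natr1.
have k0 : 0 <= (k : nat)%:R :> R by [].
have n0 : 0 <= n%:R :> R by [].
move: n%:R (k : nat)%:R n0 k0 => x z x0 z0.
rewrite -subr_ge0 (_ : _ - _ = 4 * z ^+ 4 + 17 * z ^+ 3 + 31 * z ^+ 2 + 26 * z
   + 8 + (2 * x + 2) * (6 * z ^+ 2 + 8 * z + 3)); last by ring.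
by rewrite !addr_ge0 ?mulr_ge0 ?addr_ge0 ?mulr_ge0 ?exprn_ge0.
Qed.

(** * Termwise comparison with the exact identity *)

(** The factor of a term of [height_sum] that depends on t, without the factor
    k + 1 common to all ballot numbers of height k. *)
Definition term_weight (R : realType) t k : R := (ballot t k)%:R / k.+1%:R.

(** The corresponding factor in [ballot_cut]; its ballot number has height k +
    1, so k + 2 is divided out. *)
Definition ref_weight (R : realType) t k : R := (ballot (t + k) k.+1)%:R / k.+2%:R.

Lemma term_weightE (R : realType) t k : (k <= t)%N ->
  term_weight R t k = 'C(2 * t - k, t)%:R / t.+1%:R.
Proof.
move=> /ballotE/(congr1 (fun m : nat => m%:R : R)); rewrite !natrM => e.
apply/eqP; rewrite eqr_div ?pnatr_eq0 //; apply/eqP.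
by rewrite mulrC e mulrC.
Qed.

Lemma term_weightS (R : realType) t k : (k < t)%N ->
  (2 * t%:R - k%:R) * term_weight R t k.+1 = (t%:R - k%:R) * term_weight R t k.
Proof.
move=> lt_kt; rewrite !term_weightE //; last exact: ltnW.
have := mul_bin_down (2 * t - k) t.
have -> : (2 * t - k - t = t - k)%N by lia.
have -> : ((2 * t - k).-1 = 2 * t - k.+1)%N by lia.
move/(congr1 (fun m : nat => m%:R : R)); rewrite !natrM !natrB; try lia.
by rewrite natrM !mulrA => ->.
Qed.

Lemma ref_weightE (R : realType) t k : (0 < t)%N ->
  ref_weight R t k = 'C(2 * t + k - 1, t + k)%:R / (t + k).+1%:R.
Proof.
move=> t0; have : (k.+1 <= t + k)%N by lia.
move/ballotE/(congr1 (fun m : nat => m%:R : R)); rewrite !natrM => e.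
have -> : (2 * t + k - 1 = 2 * (t + k) - k.+1)%N by lia.
apply/eqP; rewrite eqr_div ?pnatr_eq0 //; apply/eqP.
by rewrite mulrC e mulrC.
Qed.

Lemma ref_weightS (R : realType) t k : (0 < t)%N ->
  (t%:R + k%:R + 2) * ref_weight R t k.+1 = (2 * t%:R + k%:R) * ref_weight R t k.
Proof.
move=> t0; rewrite !ref_weightE // !addnS.
have := mul_bin_diag (2 * t + k) (t + k).
have -> : ((2 * t + k).-1 = 2 * t + k - 1)%N by lia.
have -> : ((2 * t + k).+1 - 1 = 2 * t + k)%N by lia.
move/(congr1 (fun m : nat => m%:R : R)); rewrite !natrM [(2 * t + k)%:R]natrD natrM => e.
rewrite [RHS]mulrA e.
have -> : (t + k).+2%:R = t%:R + k%:R + 2 :> R by rewrite -addn2 !natrD.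
have tk : t%:R + k%:R + 2 != 0 :> R by rewrite -!natrD pnatr_eq0; lia.
have tk1 : (t + k).+1%:R != 0 :> R by rewrite pnatr_eq0.
by rewrite mulrCA divff // mulr1 mulrAC divff // mul1r.
Qed.

Lemma catalanS (R : realType) m :
  m.+2%:R * (catalan m.+1)%:R = 2 * (2 * m%:R + 1) * (catalan m)%:R :> R.
Proof.
have := scaled_binomialS R m; rewrite /scaled_binomial -!catalan_bin !natrM exprS => e.
have h4 : 4 ^+ m != 0 :> R by rewrite expf_neq0.
have m1 : m.+1%:R != 0 :> R by rewrite pnatr_eq0.
rewrite -[(2 * m).+1%:R]natr1 natrM in e.
apply: (mulfI m1); apply: (mulfI h4).
transitivity (2 * 4 ^+ m * 4 ^+ m *
   (2 * m.+1%:R * (m.+2%:R * (catalan m.+1)%:R / (4 * 4 ^+ m))) : R).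
  by move: m.+1%:R m.+2%:R => x y; field; rewrite h4.
by rewrite e; move: m.+1%:R => x; field; rewrite h4.
Qed.

Lemma ref_weight_ge0 (R : realType) t k : 0 <= ref_weight R t k.
Proof. by rewrite divr_ge0. Qed.

Lemma term_weight_ge0 (R : realType) t k : 0 <= term_weight R t k.
Proof. by rewrite divr_ge0. Qed.

(** The consecutive ratios of [ref_weight] are at most 2. *)
Lemma ref_weight_le (R : realType) t k : (0 < t)%N ->
  ref_weight R t k <= 2 ^+ k * ((catalan t)%:R / 2).
Proof.
move=> t0; elim: k => [|k IHk]; first by rewrite expr0 mul1r /ref_weight addn0 ballot0.
have k0 : 0 <= k%:R :> R by []. have x0 : 0 < t%:R :> R by rewrite ltr0n.
have g0 := ref_weight_ge0 R t k.
have s0 : 0 < t%:R + k%:R + 2 :> R by lra.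
rewrite -(ler_pM2l s0) ref_weightS // exprS.
apply: (@le_trans _ _ ((2 * (t%:R + k%:R + 2)) * ref_weight R t k)).
  by rewrite ler_wpM2r //; lra.
by rewrite -!mulrA mulrCA ler_pM2l // ler_pM2l.
Qed.

(** The factor 4 * (1 - 3 / (2 (m + 2))) is the ratio of consecutive Catalan
    numbers at m = d + k. *)
Definition term_ratio (R : realType) (d t k : R) : R :=
  4 * (1 - 3 / (2 * (d + k + 2))) * ((t - k) / (2 * t - k)).

Lemma term_step (R : realType) d t k : (k < t)%N ->
  (catalan (d + k.+1))%:R * term_weight R t k.+1 =
  term_ratio d%:R t%:R k%:R * ((catalan (d + k))%:R * term_weight R t k).
Proof.
move=> lt_kt; have := term_weightS R lt_kt; have := catalanS R (d + k).
have kx : k%:R + 1 <= t%:R :> R by rewrite natr1 ler_nat.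
have k0 : 0 <= k%:R :> R by []. have d0 : 0 <= d%:R :> R by [].
rewrite -[(d + k).+2]addn2 -addnS !natrD /term_ratio.
move: (catalan _)%:R (catalan _)%:R (term_weight _ _ _) (term_weight _ _ _) => c c' u u'.
move: kx k0 d0; move: d%:R t%:R k%:R => {t k lt_kt} d t k kt k0 d0 ec eu.
have n1 : d + k + 2 != 0 by apply: lt0r_neq0; lra.
have n2 : 2 * t - k != 0 by apply: lt0r_neq0; lra.
apply: (mulfI n1); apply: (mulfI n2).
transitivity (((d + k + 2) * c') * ((2 * t - k) * u')); first by ring.
by rewrite ec eu; field; rewrite n1 n2.
Qed.

Lemma ref_step (R : realType) t k : (0 < t)%N ->
  ref_weight R t k.+1 = (2 * t%:R + k%:R) / (t%:R + k%:R + 2) * ref_weight R t k.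
Proof.
move=> t0; have n : t%:R + k%:R + 2 != 0 :> R by rewrite -!natrD pnatr_eq0; lia.
apply: (mulfI n); rewrite ref_weightS //; move: (ref_weight _ _ _) => g.
by field; rewrite n.
Qed.

Lemma term_ref0 (R : realType) d t : (0 < t)%N ->
  (catalan (d + 0))%:R * term_weight R t 0 = 2 * ((catalan d)%:R * ref_weight R t 0).
Proof.
move=> t0; rewrite addn0 /term_weight /ref_weight addn0 ballot0 // -/(catalan t) divr1.
by field.
Qed.

(** From k to k + 1 the quotient of catalan (d + k) * [term_weight] by catalan
    d * [ref_weight] is multiplied by at most 1 + 2 / t. *)
Lemma term_le_ref (R : realType) d t k : (0 < t)%N -> (k <= t)%N ->
  (catalan (d + k))%:R * term_weight R t k <=
  2 * ((catalan d)%:R * ref_weight R t k) * (1 + 2 / t%:R) ^+ k.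
Proof.
move=> t0; elim: k => [|k IHk] lt_kt; first by rewrite term_ref0 // expr0 mulr1.
have {IHk}IHk := IHk (ltnW lt_kt).
have x0 : 0 < t%:R :> R by rewrite ltr0n.
have kx : k%:R + 1 <= t%:R :> R by rewrite natr1 ler_nat.
have k0 : 0 <= k%:R :> R by []. have d0 : 0 <= d%:R :> R by [].
rewrite term_step // ref_step // exprS.
set rhs := 2 * _ * _ in IHk.
have rhs0 : 0 <= rhs.
  by rewrite /rhs !mulr_ge0 ?ref_weight_ge0 ?exprn_ge0 ?addr_ge0 ?divr_ge0.
set b := (2 * t%:R + k%:R) / _.
have -> : 2 * ((catalan d)%:R * (b * ref_weight R t k)) *
    ((1 + 2 / t%:R) * (1 + 2 / t%:R) ^+ k) = b * (1 + 2 / t%:R) * rhs.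
  by rewrite /rhs; ring.
have W0 : 0 <= (catalan (d + k))%:R * term_weight R t k by rewrite mulr_ge0 ?term_weight_ge0.
have a0 : 0 <= term_ratio d%:R t%:R k%:R :> R.
  rewrite /term_ratio; apply: mulr_ge0; last by apply: divr_ge0; lra.
  apply: mulr_ge0 => //; rewrite subr_ge0 ler_pdivrMr; lra.
apply: (@le_trans _ _ (term_ratio d%:R t%:R k%:R * rhs)); first by rewrite ler_wpM2l.
rewrite ler_wpM2r // /term_ratio /b.
apply: (@le_trans _ _ (4 * ((t%:R - k%:R) / (2 * t%:R - k%:R)))).
  rewrite ler_wpM2r //; first by apply: divr_ge0; lra.
  by rewrite ler_piMr // gerBl divr_ge0 //; lra.
move: t%:R k%:R x0 kx k0 => {a0 W0 rhs0 b rhs IHk lt_kt t0 d0} x z x0 kx k0.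
have n1 : 0 < 2 * x - z by lra.
have n2 : 0 < x + z + 2 by lra.
rewrite mulrA ler_pdivrMr // -subr_ge0.
have -> : (2 * x + z) / (x + z + 2) * (1 + 2 / x) * (2 * x - z) - 4 * (x - z) =
   z * (3 * x * z + 8 * x - 2 * z) / ((x + z + 2) * x).
  by field; rewrite !gt_eqF.
apply: divr_ge0; first apply: mulr_ge0 => //; nra.
Qed.

(** Bounds the power by exp x with x = 2 k / t <= 2, then exp x by 1 + x exp
    x. *)
Lemma expr_le_expR (R : realType) (t : R) k : 0 < t -> k%:R <= t ->
  (1 + 2 / t) ^+ k <= 1 + 2 * expR 2 * k%:R / t.
Proof.
move=> t0 kt; set x := 2 * k%:R / t.
have k0 : 0 <= k%:R :> R by [].
have x0 : 0 <= x by rewrite divr_ge0 ?mulr_ge0 // ltW.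
have x2 : x <= 2 by rewrite ler_pdivrMr //; lra.
have e1 : (1 + 2 / t) ^+ k <= expR x.
  apply: (@le_trans _ _ (expR (2 / t) ^+ k)).
    by rewrite lerXn2r ?nnegrE ?expR_ge0 ?expR_ge1Dx ?addr_ge0 ?divr_ge0 // ltW.
  by rewrite -expRM_natl le_eqVlt; apply/orP; left; apply/eqP; congr expR; rewrite /x; ring.
have e2 : expR x <= 1 + x * expR x.
  have := expR_ge1Dx (- x); rewrite expRN => h.
  have p := expR_gt0 x.
  have := ler_wpM2r (ltW p) h; rewrite mulVf ?gt_eqF // mulrDl mul1r mulNr.
  lra.
apply: (le_trans e1); apply: (le_trans e2).
have -> : 2 * expR 2 * k%:R / t = x * expR 2 by rewrite /x; ring.
by rewrite lerD2l ler_wpM2l // ler_expR.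
Qed.

(** The quotient considered in [term_le_ref] is multiplied by at least 1 - e,
    where e = k^2 / t^2 + 8 k / (3 t^2) + 3 / (2 d); the accumulated loss
    stays below k^3 / t^2 + 3 k / (2 d) because (k + 1)^3 - k^3 exceeds k^2 +
    8 k / 3. *)
Lemma term_ge_ref (R : realType) d t k : (0 < d)%N -> (0 < t)%N -> (k <= t)%N ->
  2 * ((catalan d)%:R * ref_weight R t k) *
    (1 - (k%:R ^+ 3 / t%:R ^+ 2 + 3 / 2 * k%:R / d%:R)) <=
  (catalan (d + k))%:R * term_weight R t k.
Proof.
move=> d0 t0; elim: k => [|k IHk] lt_kt.
  by rewrite term_ref0 // expr0n mulr0 !mul0r addr0 subr0 mulr1.
have {IHk}IHk := IHk (ltnW lt_kt).
have x0 : 0 < t%:R :> R by rewrite ltr0n.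
have kx : k%:R + 1 <= t%:R :> R by rewrite natr1 ler_nat.
have k0 : 0 <= k%:R :> R by []. have y0 : 0 < d%:R :> R by rewrite ltr0n.
have x00 : 0 <= t%:R :> R by []. have y00 : 0 <= d%:R :> R by [].
set E1 := (k.+1%:R ^+ 3 / _ + _).
(* Once the claimed loss exceeds 1 the lower bound is negative. *)
case: (lerP 1 E1) => [E1ge|E1lt].
  apply: (@le_trans _ _ 0); last by rewrite mulr_ge0 ?term_weight_ge0.
  by rewrite mulr_ge0_le0 ?subr_le0 // !mulr_ge0 ?ref_weight_ge0.
rewrite term_step // ref_step //.
set W := _%:R * term_weight R t k in IHk *; set E0 := k%:R ^+ 3 / _ + _ in IHk.
set Y := (catalan d)%:R * ref_weight R t k in IHk.
have Y0 : 0 <= Y by rewrite mulr_ge0 ?ref_weight_ge0.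
set b := (2 * t%:R + k%:R) / _.
have -> : 2 * ((catalan d)%:R * (b * ref_weight R t k)) = 2 * b * Y by rewrite /Y; ring.
set a := term_ratio _ _ _.
set e := k%:R ^+ 2 / t%:R ^+ 2 + 8 / 3 * k%:R / t%:R ^+ 2 + 3 / 2 / d%:R : R.
have e0 : 0 <= e.
  by rewrite /e !addr_ge0 ?divr_ge0 ?mulr_ge0 ?exprn_ge0.
have E00 : 0 <= E0 by rewrite /E0 !addr_ge0 ?divr_ge0 ?mulr_ge0 ?exprn_ge0.
have E1ge : E0 + e <= E1.
  rewrite -subr_ge0 /E1 /E0 /e -[k.+1%:R]natr1.
  move: t%:R d%:R k%:R x0 y0 k0 => x y z x0 y0 z0.
  rewrite (_ : _ - _ = (2 * z ^+ 2 + z / 3 + 1) / x ^+ 2); last first.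
    by field; rewrite !gt_eqF.
  by rewrite divr_ge0 ?exprn_ge0 ?addr_ge0 ?mulr_ge0 ?divr_ge0 // ?ltW // exprn_ge0.
have b0 : 0 <= b by rewrite divr_ge0 //; lra.
have ab : b * (1 - e) <= a.
  pose A : R := 3 / (2 * (d%:R + k%:R + 2)).
  have A0 : 0 <= A by rewrite divr_ge0 //; lra.
  have A1 : A <= 1 by rewrite ler_pdivrMr; lra.
  have A' : A <= 3 / 2 / d%:R.
    rewrite /A invfM mulrA ler_wpM2l ?divr_ge0 // lef_pV2 ?posrE //; lra.
  set B := k%:R ^+ 2 / t%:R ^+ 2 + 8 / 3 * k%:R / t%:R ^+ 2 in e {e0} E1ge *.
  have B0 : 0 <= B by rewrite /B !addr_ge0 ?divr_ge0 ?mulr_ge0 ?exprn_ge0.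
  have G : b * (1 - B) <= 4 * ((t%:R - k%:R) / (2 * t%:R - k%:R)).
    rewrite /b /B; move: t%:R k%:R x0 kx k0 => x z x0 kx k0.
    rewrite -subr_ge0 (_ : _ - _ = (24 * x ^+ 3 + (3 * z ^+ 2 + 8 * z) *
      (x ^+ 2 - z ^+ 2)) / (3 * x ^+ 2 * (2 * x - z) * (x + z + 2))); last first.
      by field; rewrite !gt_eqF //; lra.
    rewrite divr_ge0 //.
      have h : 0 <= x ^+ 2 - z ^+ 2.
        by rewrite subr_ge0 lerXn2r ?nnegrE //; lra.
      have h' := ltW x0.
      by rewrite addr_ge0 // ?mulr_ge0 // ?exprn_ge0 // addr_ge0 // mulr_ge0 // exprn_ge0.
    by rewrite !mulr_ge0 ?exprn_ge0 //; lra.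
  apply: (@le_trans _ _ ((1 - A) * (b * (1 - B)))).
    rewrite mulrCA ler_wpM2l // /e; nra.
  have -> : a = (1 - A) * (4 * ((t%:R - k%:R) / (2 * t%:R - k%:R))).
    by rewrite /a /term_ratio -/A; ring.
  by rewrite ler_wpM2l //; lra.
apply: (@le_trans _ _ (a * (2 * Y * (1 - E0)))); last first.
  rewrite ler_wpM2l // /a /term_ratio.
  apply: mulr_ge0; last by apply: divr_ge0; lra.
  apply: mulr_ge0 => //; rewrite subr_ge0 ler_pdivrMr; lra.
rewrite [leRHS](_ : _ = 2 * Y * (a * (1 - E0))); last by ring.
rewrite [leLHS](_ : _ = 2 * Y * (b * (1 - E1))); last by ring.
rewrite ler_wpM2l ?mulr_ge0 //.
apply: (@le_trans _ _ (b * (1 - e) * (1 - E0))).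
  rewrite -mulrA ler_wpM2l //; nra.
rewrite ler_wpM2r //; lra.
Qed.

(** The constant in front of (k + 1)^2 / p in [weight_error]: 2 exp 2 comes
    from the upper bound [term_le_ref], 3 / 2 from the Catalan ratio in
    [term_ge_ref]. *)
Definition drift_const (R : realType) : R := 2 * expR 2 + 3 / 2.

(** The three error terms: 1 from replacing k + 1 by k + 2, the other two from
    [term_le_ref] and [term_ge_ref]. For k > t the term itself is 0, and the
    last error dominates because k > t >= p. *)
Lemma weight_error (R : realType) d t k (p : R) : 0 < p -> p <= t%:R -> p <= d%:R ->
  `|k.+1%:R * ((catalan (d + k))%:R * term_weight R t k)
    - 2 * k.+2%:R * ((catalan d)%:R * ref_weight R t k)| <=
  2 * ((catalan d)%:R * ref_weight R t k) *
    (1 + drift_const R * k.+1%:R ^+ 2 / p + k.+1%:R ^+ 4 / p ^+ 2).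
Proof.
move=> p0 pt pd.
have t0 : (0 < t)%N by rewrite -(ltr0n R); lra.
have d0 : (0 < d)%N by rewrite -(ltr0n R); lra.
have Y0 : 0 <= (catalan d)%:R * ref_weight R t k by rewrite mulr_ge0 ?ref_weight_ge0.
have X0 : 0 <= (catalan (d + k))%:R * term_weight R t k by rewrite mulr_ge0 ?term_weight_ge0.
have k0 : 0 <= k%:R :> R by [].
have e0 := expR_gt0 (2 : R).
have pk : 0 <= k%:R / p by rewrite divr_ge0 // ltW.
have -> : k.+2%:R = k%:R + 2 :> R by rewrite -addn2 natrD.
rewrite -[k.+1%:R]natr1 /drift_const.
have yp : (k%:R + 1) ^+ 2 / p = (k%:R + 1) * (k%:R / p + p^-1).
  by field; rewrite gt_eqF.
have yp4 : (k%:R + 1) ^+ 4 / p ^+ 2 = ((k%:R + 1) ^+ 2 / p) ^+ 2.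
  by field; rewrite gt_eqF.
have ip0 : 0 < p^-1 by rewrite invr_gt0.
have yp0 : 0 <= (k%:R + 1) ^+ 2 / p by rewrite divr_ge0 ?exprn_ge0 ?ltW //; lra.
case: (leqP k t) => [le_kt|lt_tk].
  have up := term_le_ref R d t0 le_kt.
  have lo := term_ge_ref R d0 t0 le_kt.
  have kt : k%:R <= t%:R :> R by rewrite ler_nat.
  have tp : 0 < t%:R :> R by rewrite ltr0n.
  have pw := expr_le_expR tp kt.
  move: X0 Y0 up lo; set X := _ * term_weight R t k; set Y := _ * ref_weight R t k.
  move=> X0 Y0 up lo; rewrite ler_norml; apply/andP; split.
    set E := k%:R ^+ 3 / _ + _ in lo.
    have EP : (k%:R + 1) * E <= (k%:R + 1) ^+ 4 / p ^+ 2 + 3 / 2 * ((k%:R + 1) ^+ 2 / p).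
      have h1 : k%:R ^+ 3 / t%:R ^+ 2 <= (k%:R + 1) ^+ 3 / p ^+ 2.
        apply: ler_pM; rewrite ?exprn_ge0 ?invr_ge0 ?exprn_ge0 //.
          by rewrite lerXn2r ?nnegrE //; lra.
        by rewrite lef_pV2 ?posrE ?exprn_gt0 // lerXn2r ?nnegrE //; lra.
      have h2 : 3 / 2 * k%:R / d%:R <= 3 / 2 * ((k%:R + 1) / p).
        rewrite -mulrA ler_wpM2l //; apply: ler_pM; rewrite ?invr_ge0 //; first lra.
        by rewrite lef_pV2 ?posrE //; lra.
      apply: (@le_trans _ _ ((k%:R + 1) * ((k%:R + 1) ^+ 3 / p ^+ 2 +
         3 / 2 * ((k%:R + 1) / p)))).
        by rewrite ler_wpM2l //; rewrite /E; lra.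
      by rewrite le_eqVlt; apply/orP; left; apply/eqP; ring.
    have h3 : (k%:R + 1) * (2 * Y * (1 - E)) <= (k%:R + 1) * X by rewrite ler_wpM2l //; lra.
    have h4 : 2 * Y * ((k%:R + 1) * E) <= 2 * Y * ((k%:R + 1) ^+ 4 / p ^+ 2
        + 3 / 2 * ((k%:R + 1) ^+ 2 / p)) by rewrite ler_wpM2l //; lra.
    have h5 : 0 <= 2 * Y * (2 * expR 2 * ((k%:R + 1) ^+ 2 / p)).
      by apply: mulr_ge0; [lra | apply: mulr_ge0 => //; lra].
    rewrite yp4 -[_ * _ / p]mulrA in h3 h4 h5 *.
    move: h3 h4 h5; set y := k%:R + 1; set q := y ^+ 2 / p; set q4 := q ^+ 2.
    have -> : k%:R + 2 = y + 1 by rewrite /y; ring.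
    lra.
  have h1 : X <= 2 * Y * (1 + 2 * expR 2 * k%:R / t%:R).
    by apply: (le_trans up); rewrite ler_wpM2l //; lra.
  have h2 : 2 * expR 2 * k%:R / t%:R <= 2 * expR 2 * ((k%:R + 1) / p).
    rewrite -mulrA ler_wpM2l //.
    apply: ler_pM; rewrite ?invr_ge0 //; first lra.
    by rewrite lef_pV2 ?posrE //; lra.
  have h3 : (k%:R + 1) * X <= (k%:R + 1) * (2 * Y * (1 + 2 * expR 2 * ((k%:R + 1) / p))).
    apply: ler_wpM2l; first lra.
    by apply: (le_trans h1); apply: ler_wpM2l; lra.
  have h4 : 0 <= 2 * Y * ((k%:R + 1) ^+ 4 / p ^+ 2).
    by apply: mulr_ge0; [lra | rewrite yp4 sqr_ge0].
  have h5 : 0 <= 2 * Y * (3 / 2 * ((k%:R + 1) ^+ 2 / p)).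
    by apply: mulr_ge0; [lra | apply: mulr_ge0 => //; lra].
  have e6 : (k%:R + 1) * (2 * Y * (1 + 2 * expR 2 * ((k%:R + 1) / p))) =
     (k%:R + 1) * 2 * Y + 2 * Y * (2 * expR 2 * ((k%:R + 1) ^+ 2 / p)) by ring.
  rewrite -[_ * _ / p]mulrA.
  lra.
have -> : (catalan (d + k))%:R * term_weight R t k = 0 by rewrite /term_weight ballot_gt // mul0r mulr0.
rewrite mulr0 sub0r normrN ger0_norm; last by rewrite mulr_ge0 // mulr_ge0 //; lra.
have tk : t%:R <= k%:R :> R by rewrite ler_nat ltnW.
have q1 : k%:R + 1 <= (k%:R + 1) ^+ 2 / p.
  by rewrite ler_pdivlMr // expr2 ler_wpM2l //; lra.
have q2 : k%:R + 1 <= (k%:R + 1) ^+ 4 / p ^+ 2.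
  rewrite yp4; apply: (le_trans q1).
  by rewrite expr2 -[leLHS]mulr1 ler_wpM2l //; lra.
rewrite -[_ * _ / p]mulrA.
set Y := (catalan d)%:R * ref_weight R t k in Y0 *.
rewrite [leLHS](_ : _ = 2 * Y * (k%:R + 2)); last by ring.
rewrite ler_wpM2l ?mulr_ge0 //.
have : 0 <= (2 * expR 2 + 3 / 2) * ((k%:R + 1) ^+ 2 / p) by apply: mulr_ge0 => //; lra.
lra.
Qed.

(** Here the ballot number of the first part is rewritten as a matchbox
    weight, whose factor 2^k cancels the growth of [ref_weight]. *)
Lemma term_error (R : realType) d n t k (p : R) :
    0 < p -> p <= t%:R -> p <= d%:R -> (k <= n)%N ->
  `|(catalan (d + k) * ballot n k * ballot t k)%:R
    - 2 * (catalan d)%:R * (ballot n k * ballot (t + k) k.+1)%:R| <=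
  (catalan d)%:R * (catalan t)%:R / n.+1%:R *
    (k.+1%:R ^+ 1 * matchbox R n k + drift_const R / p * (k.+1%:R ^+ 3 * matchbox R n k)
     + (k.+1%:R ^+ 5 * matchbox R n k) / p ^+ 2).
Proof.
move=> p0 pt pd le_kn.
have t0 : (0 < t)%N by rewrite -(ltr0n R); lra.
have y0 : k.+1%:R != 0 :> R by rewrite pnatr_eq0.
have y1 : k.+2%:R != 0 :> R by rewrite pnatr_eq0.
have n0 : n.+1%:R != 0 :> R by rewrite pnatr_eq0.
have h2 : 2 ^+ k != 0 :> R by rewrite expf_neq0.
have br := weight_error k p0 pt pd.
rewrite !natrM.
have -> : (catalan (d + k))%:R * (ballot n k)%:R * (ballot t k)%:R
    - 2 * (catalan d)%:R * ((ballot n k)%:R * (ballot (t + k) k.+1)%:R) =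
    (ballot n k)%:R * (k.+1%:R * ((catalan (d + k))%:R * term_weight R t k)
    - 2 * k.+2%:R * ((catalan d)%:R * ref_weight R t k)) :> R.
  rewrite /term_weight /ref_weight; move: k.+1%:R k.+2%:R y0 y1 => y z y0 z0.
  by field; rewrite y0 z0.
rewrite normrM ger0_norm //.
apply: le_trans (ler_wpM2l _ br) _ => //.
have gr := ref_weight_le R k t0.
have bE : (ballot n k)%:R = k.+1%:R * matchbox R n k / (n.+1%:R * 2 ^+ k) :> R.
  have := ballotE le_kn => /(congr1 (fun m : nat => m%:R : R)); rewrite !natrM => e.
  apply: (mulfI n0); rewrite e /matchbox; move: n.+1%:R n0 => x x0.
  by field; rewrite x0 h2.
set S := (1 + _ + _).
have S0 : 0 <= S.
  have e0 := expR_gt0 (2 : R).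
  rewrite /S !addr_ge0 ?divr_ge0 ?mulr_ge0 ?exprn_ge0 ?(ltW p0) // /drift_const; lra.
apply: (@le_trans _ _ ((ballot n k)%:R * (2 ^+ k * ((catalan d)%:R * (catalan t)%:R)) * S)).
  rewrite -[leRHS]mulrA ler_wpM2l // ler_wpM2r //.
  have := ler_wpM2l (ler0n R (catalan d)) gr; lra.
rewrite bE /S; move: n.+1%:R n0 => x x0; rewrite le_eqVlt; apply/orP; left; apply/eqP.
by field; rewrite x0 h2 gt_eqF.
Qed.

(** * The sum over heights *)

(** The moments of order 3 and 5 cost factors 5 (n + 1) and 75 (n + 1)^2 over
    the first one; p stands for a common lower bound of t and d. *)
Lemma height_sum_error (R : realType) d n t (p : R) :
    0 < p -> p <= t%:R -> p <= d%:R ->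
  `|(height_sum d n t)%:R - 2 * (catalan d)%:R * (catalan (n + t))%:R| <=
  2 * n.+1%:R * (catalan d)%:R * (catalan t)%:R * (catalan n)%:R *
  (1 + 5 * drift_const R * (n.+1%:R / p) + 75 * (n.+1%:R / p) ^+ 2).
Proof.
move=> p0 pt pd.
have t0 : (0 < t)%N by rewrite -(ltr0n R); lra.
rewrite -(ballot_cut n t0) /height_sum !natr_sum mulr_sumr -sumrB.
apply: (le_trans (ler_norm_sum _ _ _)).
apply: (@le_trans _ _ (\sum_(k < n.+1) (catalan d)%:R * (catalan t)%:R / n.+1%:R *
    (k.+1%:R ^+ 1 * matchbox R n k + drift_const R / p * (k.+1%:R ^+ 3 * matchbox R n k)
     + (k.+1%:R ^+ 5 * matchbox R n k) / p ^+ 2))).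
  by apply: ler_sum => k _; apply: term_error => //; rewrite -ltnS.
rewrite -mulr_sumr !big_split /= -mulr_suml -mulr_sumr.
rewrite -/(moment R 1 n) -/(moment R 3 n) -/(moment R 5 n).
have n0 : 0 <= n%:R :> R by [].
have e0 := expR_gt0 (2 : R).
have m1 : moment R 1 n = (2 * n%:R + 1) * n.+1%:R * (catalan n)%:R.
  by rewrite moment1 -catalan_bin natrM mulrA.
have m10 : 0 <= moment R 1 n by rewrite m1 !mulr_ge0 //; lra.
have m3 := moment3_le R n; have m5 := moment5_le R n.
set x : R := n.+1%:R.
have xE : x = n%:R + 1 by rewrite /x natr1.
have x0 : 0 < x by lra.
have m3' : moment R 3 n <= 5 * x * moment R 1 n.
  by apply: (le_trans m3); rewrite ler_wpM2r //; lra.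
have m5' : moment R 5 n <= 75 * x ^+ 2 * moment R 1 n.
  apply: (le_trans m5); apply: (@le_trans _ _ (15 * x * moment R 3 n)).
    rewrite ler_wpM2r //; last lra.
    by rewrite sumr_ge0 // => k _; rewrite mulr_ge0 ?matchbox_ge0.
  by have := @ler_wpM2l _ (15 * x) _ _ _ m3'; lra.
have K0 : 0 <= drift_const R / p by rewrite divr_ge0 /drift_const ?ltW //; lra.
apply: (@le_trans _ _ ((catalan d)%:R * (catalan t)%:R / x *
   (moment R 1 n * (1 + 5 * drift_const R * (x / p) + 75 * (x / p) ^+ 2)))).
  apply: ler_wpM2l; first by rewrite !mulr_ge0 // invr_ge0 ltW.
  have h3 := ler_wpM2l K0 m3'.
  have ip2 : 0 <= (p ^+ 2)^-1 by rewrite invr_ge0 exprn_ge0 // ltW.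
  have h5 := ler_wpM2r ip2 m5'.
  rewrite [leRHS](_ : _ = moment R 1 n + drift_const R / p * (5 * x * moment R 1 n)
    + 75 * x ^+ 2 * moment R 1 n / p ^+ 2); last by field; rewrite gt_eqF.
  by rewrite !lerD.
have S0 : 0 <= 1 + 5 * drift_const R * (x / p) + 75 * (x / p) ^+ 2.
  have -> : 5 * drift_const R * (x / p) = 5 * x * (drift_const R / p) by ring.
  have := mulr_ge0 (ltW x0) K0; have := sqr_ge0 (x / p); lra.
have m1' : moment R 1 n <= 2 * x ^+ 2 * (catalan n)%:R.
  by rewrite m1 ler_wpM2r // -/x expr2 mulrA ler_wpM2r //; lra.
rewrite [leLHS]mulrA; apply: ler_wpM2r => //.
rewrite [leRHS](_ : _ = (catalan d)%:R * (catalan t)%:R / x * (2 * x ^+ 2 * (catalan n)%:R)).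
  by apply: ler_wpM2l => //; rewrite !mulr_ge0 // invr_ge0 ltW.
by field; rewrite gt_eqF.
Qed.

(** * Asymptotics *)

Lemma pow32_gt0 (R : realType) (x : R) : 0 < x -> 0 < pow32 x.
Proof. by move=> x0; rewrite /pow32 mulr_gt0 ?sqrtr_gt0. Qed.

Lemma pow32M (R : realType) (x y : R) : 0 <= x -> pow32 (x * y) = pow32 x * pow32 y.
Proof. by move=> x0; rewrite /pow32 sqrtrM //; ring. Qed.

Lemma ler_pow32 (R : realType) (x y : R) : 0 <= x -> x <= y -> pow32 x <= pow32 y.
Proof.
by move=> x0 xy; rewrite /pow32 ler_pM ?sqrtr_ge0 ?ler_wsqrtr.
Qed.

Lemma pow32_powR (R : realType) (x : R) : 0 < x -> x `^ (3 / 2) = pow32 x.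
Proof.
move=> x0; rewrite (_ : 3 / 2 = 1 + 2^-1 :> R); last by field.
by rewrite powRD ?gt_eqF ?implybT // powRr1 ?ltW // powR12_sqrt ?ltW.
Qed.

(** As sqrt (1 + 1/m) <= 1 + 1/m <= 2, the ratio is at most (1 + 1/m)^2, hence
    at most 1 + 3/m. *)
Lemma pow32S_le (R : realType) m (p : R) : 1 <= p -> p <= m%:R ->
  pow32 m.+1%:R <= (1 + 3 / p) * pow32 m%:R.
Proof.
move=> p1 pm; have m0 : 0 < m%:R :> R by lra.
have mp : m%:R^-1 <= p^-1 by rewrite lef_pV2 ?posrE //; lra.
have im0 : 0 < m%:R^-1 :> R by rewrite invr_gt0.
have im1 : m%:R^-1 <= 1 :> R by rewrite invf_le1 //; lra.
have -> : m.+1%:R = (1 + m%:R^-1) * m%:R :> R.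
  by rewrite mulrDl mul1r mulVf ?gt_eqF // -natr1 addrC.
rewrite pow32M; last lra.
apply: ler_wpM2r; first by rewrite ltW ?pow32_gt0.
have sq : Num.sqrt (1 + m%:R^-1) <= 1 + m%:R^-1 :> R.
  rewrite -[leRHS]ger0_norm; last lra.
  by rewrite -sqrtr_sqr ler_wsqrtr // expr2; nra.
apply: (@le_trans _ _ ((1 + m%:R^-1) * (1 + m%:R^-1))).
  by apply: ler_wpM2l => //; lra.
nra.
Qed.

Lemma scaled_catalan_gt0 (R : realType) m : 0 < scaled_catalan R m.
Proof.
rewrite scaled_catalanE; apply: divr_gt0 => //; apply: mulr_gt0; last exact: scaled_binomial_gt0.
by rewrite sqrtr_gt0 pi_gt0.
Qed.

Lemma ratio_near1 (R : realType) (a b c s : R) :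
  0 <= s <= 3 -> 0 < c -> 1 <= (1 + s) * a -> a <= 1 -> 1 <= b -> b <= 1 + s ->
  1 <= (1 + s) * c -> c <= 1 -> `|a * b / c - 1| <= 5 * s.
Proof.
move=> /andP[s0 s3] c0 a1 a2 b1 b2 c1 c2.
have a0 : 0 < a by nra.
have ca : a * b / c <= (1 + s) ^+ 2.
  rewrite ler_pdivrMr //; apply: (@le_trans _ _ b); first nra.
  rewrite expr2 -mulrA; nra.
have ca' : a <= a * b / c by rewrite ler_pdivlMr //; nra.
rewrite ler_norml; apply/andP; split; nra.
Qed.

Lemma catalan_scaled (R : realType) m :
  (catalan m)%:R = scaled_catalan R m * 4 ^+ m / Num.sqrt pi :> R.
Proof.
have h4 : 4 ^+ m != 0 :> R by rewrite expf_neq0.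
have hp : Num.sqrt pi != 0 :> R by rewrite gt_eqF // sqrtr_gt0 pi_gt0.
by rewrite /scaled_catalan; field; rewrite h4 hp.
Qed.

Lemma catalan_gt0 (R : realType) m : 0 < (catalan m)%:R :> R.
Proof.
by rewrite catalan_scaled divr_gt0 ?sqrtr_gt0 ?pi_gt0 // mulr_gt0 ?scaled_catalan_gt0 ?exprn_gt0.
Qed.

(** The bracket of [height_sum_error] for n + 1 <= N and p = eps * N, divided
    by the two factors that come from scaling [pow32] by eps and eps / 2. *)
Definition cut_bound (R : realType) (eps : R) : R :=
  (1 + 5 * drift_const R * eps^-1 + 75 * eps^-1 ^+ 2) / (pow32 eps * pow32 (eps / 2)).

Lemma drift_const_gt0 (R : realType) : 0 < drift_const R.
Proof. by rewrite /drift_const; have := expR_gt0 (2 : R); lra. Qed.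

Lemma cut_bound_gt0 (R : realType) (eps : R) : 0 < eps -> 0 < cut_bound eps.
Proof.
move=> e0; have i0 : 0 < eps^-1 by rewrite invr_gt0.
rewrite /cut_bound divr_gt0 //; last by rewrite mulr_gt0 ?pow32_gt0 //; lra.
have h1 : 0 < drift_const R * eps^-1 by rewrite mulr_gt0 ?drift_const_gt0.
have := sqr_ge0 eps^-1; rewrite -mulrA; lra.
Qed.

(** Relative form of [height_sum_error]: by the bounds on Catalan numbers, N *
    catalan t * catalan n / catalan (n + t) is O(N^(-1/2)) when n and t are of
    order N. *)
Lemma height_sum_relative (R : realType) (eps : R) N d n t :
    0 < eps -> N = (d + n + t).+1 -> eps * N%:R <= d%:R -> eps * N%:R <= t%:R ->
    eps / 2 * N%:R <= n%:R ->
  `|(height_sum d n t)%:R / (2 * (catalan d)%:R * (catalan (n + t))%:R) - 1| <=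
  cut_bound eps / Num.sqrt N%:R.
Proof.
move=> e0 eqN le_d le_t le_n.
have le_nN : (n.+1 <= N)%N by clear -eqN; lia.
have le_ntN : ((n + t).+1 <= N)%N by clear -eqN; lia.
have N0 : 0 < N%:R :> R by rewrite ltr0n eqN.
have p0 : 0 < eps * N%:R by rewrite mulr_gt0.
have := height_sum_error n p0 le_t le_d.
have cd := catalan_gt0 R d; have cnt := catalan_gt0 R (n + t).
set D := 2 * _ * (catalan (n + t))%:R.
have D0 : 0 < D by rewrite /D; apply: mulr_gt0 => //; lra.
have e1 : (height_sum d n t)%:R / D - 1 = ((height_sum d n t)%:R - D) / D.
  by field; rewrite gt_eqF.
rewrite e1 normrM [`|D^-1|]ger0_norm; last by rewrite invr_ge0 ltW.
move=> err.
rewrite ler_pdivrMr //; apply: (le_trans err).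
have nN : n.+1%:R <= N%:R :> R by rewrite ler_nat.
have S1 : 1 + 5 * drift_const R * (n.+1%:R / (eps * N%:R)) + 75 * (n.+1%:R / (eps * N%:R)) ^+ 2
   <= 1 + 5 * drift_const R * eps^-1 + 75 * eps^-1 ^+ 2.
  have h : n.+1%:R / (eps * N%:R) <= eps^-1.
    by rewrite ler_pdivrMr // mulrA mulVf ?mul1r // gt_eqF.
  have h0 : 0 <= n.+1%:R / (eps * N%:R) by rewrite divr_ge0 // ltW.
  rewrite !lerD ?ler_wpM2l //; first by rewrite mulr_ge0 // ltW // drift_const_gt0.
  by rewrite lerXn2r ?nnegrE //; lra.
set K := 1 + _ + _ in S1 *; set K' := 1 + _ + _ in S1.
have cut : cut_bound eps = K' / (pow32 eps * pow32 (eps / 2)) by [].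
have K0 : 0 <= K'.
  have i0 : 0 < eps^-1 by rewrite invr_gt0.
  have h1 : 0 < drift_const R * eps^-1 by rewrite mulr_gt0 ?drift_const_gt0.
  by have := sqr_ge0 eps^-1; rewrite /K' -mulrA; lra.
have x1 : 0 < pow32 eps by rewrite pow32_gt0.
have x2 : 0 < pow32 (eps / 2) by rewrite pow32_gt0 //; lra.
have xN : 0 < pow32 N%:R :> R by rewrite pow32_gt0.
have ct : scaled_catalan R t * (pow32 eps * pow32 N%:R) <= 1.
  apply: le_trans (scaled_catalan_le R t); apply: ler_wpM2l; first exact/ltW/scaled_catalan_gt0.
  by rewrite -pow32M; [apply: ler_pow32 => //; exact: ltW | exact: ltW].
have cn : scaled_catalan R n * (pow32 (eps / 2) * pow32 N%:R) <= 1.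
  apply: le_trans (scaled_catalan_le R n); apply: ler_wpM2l; first exact/ltW/scaled_catalan_gt0.
  by rewrite -pow32M; [apply: ler_pow32 => //; apply: mulr_ge0 => //; lra | lra].
have c1 : 1 <= scaled_catalan R (n + t) * pow32 N%:R.
  apply: (le_trans (scaled_catalan_ge R (n + t))); apply: ler_wpM2l; first exact/ltW/scaled_catalan_gt0.
  by apply: ler_pow32; rewrite ?ler_nat.
have pi1 : 1 <= Num.sqrt pi :> R.
  by rewrite -[leLHS]sqrtr1 ler_wsqrtr //; have := pi_ge2 R; lra.
set X := pow32 N%:R in ct cn c1 xN.
have sN : 0 < Num.sqrt N%:R :> R by rewrite sqrtr_gt0.
have XE : X = N%:R * Num.sqrt N%:R by [].
have nt0 := scaled_catalan_gt0 R t; have nn0 := scaled_catalan_gt0 R n.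
have ct' : scaled_catalan R t <= (pow32 eps * X)^-1.
  by rewrite -[leRHS]mul1r ler_pdivlMr // mulr_gt0.
have cn' : scaled_catalan R n <= (pow32 (eps / 2) * X)^-1.
  by rewrite -[leRHS]mul1r ler_pdivlMr // mulr_gt0.
have c1' : X^-1 <= scaled_catalan R (n + t) by rewrite -[leLHS]mul1r ler_pdivrMr.
have q0 : 0 < Num.sqrt pi :> R by lra.
have h4 : 0 < 4 ^+ n :> R by rewrite exprn_gt0.
have h4' : 0 < 4 ^+ t :> R by rewrite exprn_gt0.
have core : n.+1%:R * (scaled_catalan R t * scaled_catalan R n) * K <=
    cut_bound eps / Num.sqrt N%:R * scaled_catalan R (n + t) * Num.sqrt pi.
  apply: (@le_trans _ _ (N%:R * ((pow32 eps * X)^-1 * (pow32 (eps / 2) * X)^-1) * K')).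
    have K00 : 0 <= K.
      have i0 : 0 <= n.+1%:R / (eps * N%:R) by rewrite divr_ge0 // ltW.
      have h1 : 0 <= drift_const R * (n.+1%:R / (eps * N%:R)).
        by rewrite mulr_ge0 // ltW // drift_const_gt0.
      by have := sqr_ge0 (n.+1%:R / (eps * N%:R)); rewrite /K -mulrA; lra.
    apply: ler_pM => //; first by rewrite !mulr_ge0 // ltW.
    apply: ler_pM => //; first by rewrite mulr_ge0 // ltW.
    by apply: ler_pM => //; rewrite ltW.
  apply: (@le_trans _ _ (cut_bound eps / Num.sqrt N%:R * X^-1 * 1)).
    rewrite le_eqVlt; apply/orP; left; apply/eqP; rewrite cut XE.
    by field; rewrite !gt_eqF.
  have B0 : 0 <= cut_bound eps / Num.sqrt N%:R by rewrite divr_ge0 ?ltW ?cut_bound_gt0.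
  apply: ler_pM => //; first by rewrite mulr_ge0 // invr_ge0 ltW.
  by rewrite ler_wpM2l.
rewrite [leLHS](_ : _ = 2 * (catalan d)%:R * (4 ^+ n * 4 ^+ t) / Num.sqrt pi ^+ 2 *
   (n.+1%:R * (scaled_catalan R t * scaled_catalan R n) * K)); last first.
  by rewrite (catalan_scaled _ t) (catalan_scaled _ n); field; rewrite gt_eqF.
rewrite [leRHS](_ : _ = 2 * (catalan d)%:R * (4 ^+ n * 4 ^+ t) / Num.sqrt pi ^+ 2 *
   (cut_bound eps / Num.sqrt N%:R * scaled_catalan R (n + t) * Num.sqrt pi)); last first.
  rewrite /D (catalan_scaled _ (n + t)) exprD; field.
  by rewrite !gt_eqF.
apply: ler_wpM2l => //.
Qed.

(** The leading term of the theorem with its powers of N collected; d is the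
    difference between position and value. *)
Definition limit_density (R : realType) (N d : nat) : R :=
  pow32 N%:R / (2 * Num.sqrt pi * pow32 (N - d)%:R * pow32 d%:R).

(** After cancelling 4^N and sqrt pi, the ratio consists of three factors
    [scaled_catalan] * [pow32], each within a factor 1 + 3 / p of 1. *)
Lemma catalan_product_ratio (R : realType) (p : R) N d m :
    1 <= p -> N = (d + m).+1 -> p <= d%:R -> p <= m%:R ->
  `|2 * (catalan d)%:R * (catalan m)%:R / (catalan N)%:R / limit_density R N d - 1|
    <= 15 / p.
Proof.
move=> p1 eqN pd pm.
have pN : p <= N%:R by apply: (le_trans pd); rewrite ler_nat; lia.
have d0 : 0 < d%:R :> R by lra.
have m0 : 0 < m%:R :> R by lra.
have N0 : 0 < N%:R :> R by lra.
have NdE : (N - d = m.+1)%N by lia.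
have q0 : 0 < Num.sqrt pi :> R by rewrite sqrtr_gt0 pi_gt0.
have xd := pow32_gt0 d0; have xN := pow32_gt0 N0.
have xm : 0 < pow32 m.+1%:R :> R by rewrite pow32_gt0.
have h4 : 0 < 4 ^+ d :> R by rewrite exprn_gt0.
have h4' : 0 < 4 ^+ m :> R by rewrite exprn_gt0.
have nN := scaled_catalan_gt0 R N.
have -> : 2 * (catalan d)%:R * (catalan m)%:R / (catalan N)%:R / limit_density R N d
  = (scaled_catalan R d * pow32 d%:R) * (scaled_catalan R m * pow32 m.+1%:R) / (scaled_catalan R N * pow32 N%:R).
  have e4 : 4 ^+ N = 4 * (4 ^+ d * 4 ^+ m) :> R by rewrite eqN exprS exprD.
  rewrite /limit_density NdE !catalan_scaled e4.
  by field; rewrite !gt_eqF.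
have ip : 0 < p^-1 by rewrite invr_gt0; lra.
have ip1 : p^-1 <= 1 by rewrite invf_le1 //; lra.
have -> : 15 / p = 5 * (3 / p) by ring.
have shift k : p <= k%:R -> scaled_catalan R k * pow32 k.+1%:R <= (1 + 3 / p) * (scaled_catalan R k * pow32 k%:R).
  by move=> pk; rewrite [leRHS]mulrCA; apply: ler_wpM2l (pow32S_le p1 pk); exact/ltW/scaled_catalan_gt0.
have c0 : 0 < scaled_catalan R N * pow32 N%:R by apply: mulr_gt0.
apply: ratio_near1; rewrite ?scaled_catalan_le ?scaled_catalan_ge //.
- by apply/andP; split; lra.
- exact: le_trans (scaled_catalan_ge R d) (shift _ pd).
- apply: (le_trans (shift _ pm)); apply: ler_piMr (scaled_catalan_le R m); lra.
- exact: le_trans (scaled_catalan_ge R N) (shift _ pN).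
Qed.

Lemma limit_densityE (R : realType) (N d : nat) : (0 < d < N)%N ->
  N%:R `^ (- (3 / 2)) /
      (2 * Num.sqrt pi * (1 - d%:R / N%:R) `^ (3 / 2) * (d%:R / N%:R) `^ (3 / 2))
  = limit_density R N d.
Proof.
move=> /andP[d0 dN].
have N0 : 0 < N%:R :> R by rewrite ltr0n (leq_trans d0 (ltnW dN)).
have d0' : 0 < d%:R :> R by rewrite ltr0n.
have Nd0 : 0 < (N - d)%:R :> R by rewrite ltr0n subn_gt0.
have -> : 1 - d%:R / N%:R = (N - d)%:R / N%:R :> R.
  by rewrite natrB 1?ltnW // mulrBl divff ?gt_eqF.
rewrite powRN !pow32_powR ?divr_gt0 // /limit_density.
have xN := pow32_gt0 N0; have xd := pow32_gt0 d0'; have xNd := pow32_gt0 Nd0.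
have q0 : 0 < Num.sqrt pi :> R by rewrite sqrtr_gt0 pi_gt0.
have e u : 0 < u -> pow32 (u / N%:R) = pow32 u / pow32 N%:R :> R.
  move=> u0; apply: (mulIf (lt0r_neq0 xN)).
  rewrite -pow32M; last by rewrite divr_ge0 // ltW.
  by rewrite !mulfVK ?gt_eqF.
by rewrite !e //; field; rewrite !gt_eqF.
Qed.

Theorem theorem2p7 (R : realType) (theta : R)
    (theta_gt0 : 0 < theta) (theta_lt : theta < 1 / 6) :
  forall eps : R, 0 < eps ->
  exists (C : R) (N1 : nat),
  forall N t j : nat,
    (N1 <= N)%N ->
    eps * N%:R < j%:R ->
    eps * N%:R < N%:R - t%:R - j%:R ->
    eps * N%:R < t%:R ->
    exists delta : R,
      `|delta| <= C * N%:R `^ (3 * theta - 1 / 2) /\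
      P312 R (Sbullet N (N - t) j) =
        N%:R `^ (- (3 / 2)) /
          (2 * Num.sqrt pi
           * (1 - (N%:R - t%:R - j%:R) / N%:R) `^ (3 / 2)
           * ((N%:R - t%:R - j%:R) / N%:R) `^ (3 / 2))
        * (1 + delta).
Proof.
move=> eps eps0.
pose K := cut_bound eps; pose A := 15 / eps.
(* N1 makes eps * N >= 2, so that n = j - 1 is at least eps * N / 2. *)
exists ((1 + A) * K + A), (Num.bound (2 / eps)).+1 => N t j.
move=> leN ltj ltd ltt.
have K0 : 0 < K := cut_bound_gt0 eps0.
have A0 : 0 < A by rewrite divr_gt0.
have N0 : 0 < N%:R :> R by rewrite ltr0n (leq_trans _ leN).
have eN : 2 <= eps * N%:R.
  rewrite mulrC -ler_pdivrMr //; apply: (@le_trans _ _ (Num.bound (2 / eps))%:R).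
    by apply/ltW/archi_boundP; rewrite divr_ge0 // ltW.
  by rewrite ler_nat ltnW.
have ltjN : (j + t < N)%N by rewrite -(ltr_nat R) natrD; lra.
have j0 : (0 < j)%N by rewrite -(ltr0n R); lra.
have jd0 : (0 < j < N - t)%N by clear -ltjN j0; lia.
pose d := (N - t - j)%N; pose n := j.-1.
have eqN : N = (d + n + t).+1 by rewrite /d /n; clear -ltjN j0; lia.
have dN0 : (0 < d < N)%N by rewrite /d; clear -ltjN j0; lia.
have dE : N%:R - t%:R - j%:R = d%:R :> R.
  by rewrite /d !natrB //; clear -ltjN; lia.
have nE : n%:R + 1 = j%:R :> R by rewrite natr1 /n prednK.
rewrite dE in ltd *; rewrite limit_densityE //.
have le_n : eps / 2 * N%:R <= n%:R.
  have -> : eps / 2 * N%:R = eps * N%:R / 2 by ring.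
  lra.
have etaP := height_sum_relative eps0 eqN (ltW ltd) (ltW ltt) le_n.
have p1 : 1 <= eps * N%:R by lra.
have eqN' : N = (d + (n + t)).+1 by rewrite addnA.
have pnt : eps * N%:R <= (n + t)%:R.
  by apply: (le_trans (ltW ltt)); rewrite ler_nat leq_addl.
have := catalan_product_ratio p1 eqN' (ltW ltd) pnt.
(* The probability is limit_density * rho * eta, with rho and eta close to 1. *)
have L0 : 0 < limit_density R N d.
  have d0 : 0 < d%:R :> R by lra.
  have Nd0 : 0 < (N - d)%:R :> R by rewrite ltr0n subn_gt0; case/andP: dN0.
  apply: divr_gt0; first exact: pow32_gt0.
  apply: mulr_gt0; last exact: pow32_gt0.
  apply: mulr_gt0; last exact: pow32_gt0.
  by rewrite mulr_gt0 // sqrtr_gt0 pi_gt0.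
have cd := catalan_gt0 R d; have cnt := catalan_gt0 R (n + t).
have cN := catalan_gt0 R N.
set rho := (X in `|X - 1|) => rhoP.
pose eta : R := (height_sum d n t)%:R / (2 * (catalan d)%:R * (catalan (n + t))%:R).
rewrite -/eta in etaP.
exists (rho * eta - 1); split; last first.
  rewrite /P312 card_S312T card_Sbullet // -/d -/n /rho /eta addrC subrK.
  move: (limit_density _ _ _) (height_sum _ _ _)%:R L0 => L F L0.
  by field; rewrite !gt_eqF.
have N1 : 1 <= N%:R :> R by rewrite ler1n (leq_trans _ leN).
have s1 : 1 <= Num.sqrt N%:R :> R by rewrite -[leLHS]sqrtr1 ler_wsqrtr.
have s0 : 0 < Num.sqrt N%:R :> R by lra.
have sN : N%:R^-1 <= (Num.sqrt N%:R)^-1 :> R.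
  rewrite lef_pV2 ?posrE // -[leRHS]sqr_sqrtr; last exact: ltW.
  by rewrite expr2; apply: ler_peMl => //; exact: ltW.
have sth : (Num.sqrt N%:R)^-1 <= N%:R `^ (3 * theta - 1 / 2) :> R.
  rewrite -powR12_sqrt; last exact: ltW.
  by rewrite -powRN ler_powR //; lra.
have rho1 : `|rho - 1| <= A / Num.sqrt N%:R.
  by apply: (le_trans rhoP); rewrite invfM mulrA; apply: ler_wpM2l sN; exact: ltW.
have rho2 : `|rho| <= 1 + A.
  have -> : rho = 1 + (rho - 1) by ring.
  apply: (le_trans (ler_normD _ _)); rewrite normr1 lerD2l.
  apply: (le_trans rho1); rewrite ler_pdivrMr //; apply: ler_peMr => //; exact: ltW.
have -> : rho * eta - 1 = rho * (eta - 1) + (rho - 1) by ring.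
apply: (le_trans (ler_normD _ _)); rewrite normrM.
apply: (@le_trans _ _ (((1 + A) * K + A) / Num.sqrt N%:R)).
  rewrite mulrDl; apply: lerD => //; rewrite -mulrA.
  by apply: ler_pM.
apply: ler_wpM2l => //; apply/ltW/addr_gt0 => //; apply: mulr_gt0 => //; lra.
Qed.
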